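(* Let $\bar X=(\bar X_t)_{t\in\mathbb Z}$, $\bar Y=(\bar Y_t)_{t\in\mathbb Z}$ and $\bar Z=(\bar Z_t)_{t\in\mathbb Z}$ be stationary time-homogeneous Markov chains with time indexed by $\mathbb Z$ and countable state spaces $A$, $B$ and $C$ respectively. Suppose that for maps $f:A\to C$ and $g:B\to C$, $$(f(\bar X_t))_{t\in\mathbb Z}\overset{d}{=}\bar Z\overset{d}{=}(g(\bar Y_t))_{t\in\mathbb Z}.$$ Then there is a stationary Markov chain $(X_t,Y_t)_{t\in\mathbb Z}$ such that $(X_t)_{t\in\mathbb Z}\overset{d}{=}\bar X$, $(Y_t)_{t\in\mathbb Z}\overset{d}{=}\bar Y$, and $f(X_t)=g(Y_t)$ for all $t\in\mathbb Z$. Moreover, it may be chosen so that, in addition, $(X_t)_{t\in\mathbb Z}$ and $(Y_t)_{t\in\mathbb Z}$ are conditionally independent given $(f(X_t))_{t\in\mathbb Z}$.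
   Context: A stochastic process $(X_t)_{t\in\mathbb Z}$ is stationary if it is equal in distribution to $(X_{t+1})_{t\in\mathbb Z}$. $\overset{d}{=}$ denotes equality in law of processes. *)

(* Defs.v *)
From HB Require Import structures.
From mathcomp Require Export all_boot all_order all_algebra.
From mathcomp Require Export all_classical all_reals all_analysis.

Set Implicit Arguments.
Unset Strict Implicit.
Unset Printing Implicit Defensive.

Import Order.TTheory GRing.Theory Num.Theory.

Local Open Scope classical_set_scope.
Local Open Scope ring_scope.

(* A countable state space is a countType with the discrete sigma-algebra. It
   carries no measurableType structure because that would require a
   distinguished point. *)

Definition path_measurable (A : Type) : set (set (int -> A)) :=
  <<s [set E | exists t (S : set A), E = [set x | S (x t)]] >>.
Arguments path_measurable A _ : clear implicits.

Section processes.
Context {d : measure_display} {T : measurableType d} {R : realType}.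
Variable P : probability T R.

Definition is_process (A : Type) (X : int -> T -> A) : Prop :=
  forall t (S : set A), measurable (X t @^-1` S).

Definition path_of (A : Type) (X : int -> T -> A) : T -> int -> A :=
  fun w t => X t w.

Definition sigma_process (A : Type) (X : int -> T -> A) : set (set T) :=
  preimage_set_system setT (path_of X) (path_measurable A).

(* P(E | F); only meaningful when P F > 0 *)
Definition cprob (E F : set T) : R := fine (P (E `&` F)) / fine (P F).

Definition markov_property (A : Type) (X : int -> T -> A) : Prop :=
  forall (t : int) (n : nat) (x : nat -> A) (b : A),
    let past := [set w | forall k, (k <= n)%N -> X (t - k%:Z) w = x k] in
    (0 < P past)%E ->
    cprob [set w | X (t + 1) w = b] past =
    cprob [set w | X (t + 1) w = b] [set w | X t w = x 0%N].

Definition time_homogeneous (A : Type) (X : int -> T -> A) : Prop :=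
  forall (s t : int) (a b : A),
    (0 < P [set w | X s w = a])%E -> (0 < P [set w | X t w = a])%E ->
    cprob [set w | X (s + 1) w = b] [set w | X s w = a] =
    cprob [set w | X (t + 1) w = b] [set w | X t w = a].

(* h is a version of the conditional probability P(E | G), for a
   sub-sigma-algebra G *)
Definition is_cond_prob (G : set (set T)) (E : set T) (h : T -> R) : Prop :=
  [/\ forall B : set R, measurable B -> G (h @^-1` B),
      P.-integrable setT (EFin \o h) &
      forall D, G D -> (\int[P]_(w in D) (h w)%:E = P (E `&` D))%E].

(* P(E `&` F | sigma(W)) = P(E | sigma(W)) P(F | sigma(W)) a.s. for all E in
   sigma(X) and F in sigma(Y). Versions are a.s. unique, so it does not matter
   which ones are exhibited. *)
Definition cond_independent (A B C : Type)
    (X : int -> T -> A) (Y : int -> T -> B) (W : int -> T -> C) : Prop :=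
  forall E F, sigma_process X E -> sigma_process Y F ->
    exists hE hF hEF : T -> R,
      [/\ is_cond_prob (sigma_process W) E hE,
          is_cond_prob (sigma_process W) F hF,
          is_cond_prob (sigma_process W) (E `&` F) hEF &
          {ae P, forall w, hEF w = hE w * hF w}].

End processes.

Definition eq_law (R : realType) (A : Type)
    (d1 : measure_display) (T1 : measurableType d1) (P1 : probability T1 R)
    (X1 : int -> T1 -> A)
    (d2 : measure_display) (T2 : measurableType d2) (P2 : probability T2 R)
    (X2 : int -> T2 -> A) : Prop :=
  forall E, path_measurable A E ->
    P1 (path_of X1 @^-1` E) = P2 (path_of X2 @^-1` E).

Definition stationary (R : realType) (A : Type)
    (d : measure_display) (T : measurableType d) (P : probability T R)
    (X : int -> T -> A) : Prop :=
  eq_law P X P (fun t => X (t + 1)).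

Definition stationary_markov_chain (R : realType) (A : countType)
    (d : measure_display) (T : measurableType d) (P : probability T R)
    (X : int -> T -> A) : Prop :=
  [/\ is_process X, stationary P X, markov_property P X
    & time_homogeneous P X].

(* Main.v *)
Require Import Defs.
From HB Require Import structures.
From mathcomp Require Import all_boot all_order all_algebra.
From mathcomp Require Import all_classical all_reals all_analysis.
From mathcomp Require Import measurable_realfun.
From mathcomp Require Import zify lra.

Set Implicit Arguments.
Unset Strict Implicit.
Unset Printing Implicit Defensive.

Import Order.TTheory GRing.Theory Num.Theory.

Local Open Scope classical_set_scope.
Local Open Scope ring_scope.

(** The coupling is the relatively independent joining of the two chains over
    their common image. Let Q be the law of Z on the path space of C. For an
    event E about X, the measure sending D to P(X in E, f(X) in D) is
    dominated by Q; its density u_E is the conditional probability of E given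
    Z. Let v_F be the analogous density for an event F about Y. The joint law
    gives E x F the mass J(E, F), the Q-integral of u_E v_F ([relprod]).

    The form J is a measure in each argument and has the two given laws as
    marginals. It is shift-invariant, because the shift carries densities to
    densities and J is insensitive to their choice ([relprod_shift]). A path
    over a countable alphabet is coded by a point of the unit interval through
    nested subintervals ([sequence_space]), so that J is the joint law of a pair
    of processes. Since u_E v_F vanishes when E and F force different values
    of Z at some time, f(X) and g(Y) agree outside a null set, which is
    removed by redirecting its points to a good one ([realization]). By the
    very definition of J, the product of u_E(Z) and v_F(Z) is the conditional
    probability of the joint event, which is the conditional independence.

    The Markov property of the pair is the part that uses that Z itself is
    Markov. Fix a time t and states with f(a) = g(b) = c. On the event X_t = a
    the past and the future of X are independent, and on Z_t = c those of Z
    are ([markov_splitting]). Hence, for a past event, the event X_t = a and a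
    future event taken together, the density is a constant times the indicator
    of z_t = c, a function of the past of z and a function of its future
    ([factored_cond_density]). Multiplying this by the analogous density for Y and
    integrating over the independent past and future of Z shows that J itself
    splits into a past factor and a future factor on X_t = a, Y_t = b
    ([relprod_splitting]), and this is the Markov property. *)

(** * Image measures, countable fibres and densities *)

Lemma measurable_preimage d d' (T : measurableType d) (T' : measurableType d')
    (h : T -> T') (mh : measurable_fun setT h) D :
  measurable D -> measurable (h @^-1` D).
Proof. by move=> mD; rewrite -[X in measurable X]setTI; exact: mh. Qed.

(** Fixing one event and letting another vary gives a measure of this form; such
    measures are what the uniqueness arguments compare. The proofs of measurability are arguments so that the
    measure structure can be inferred. *)
Definition restr_image d d' (T : measurableType d) (T' : measurableType d')
    (R : realType) (m : set T -> \bar R) (E : set T) (h : T -> T')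
    (mE : measurable E) (mh : measurable_fun setT h) (D : set T') : \bar R :=
  m (E `&` h @^-1` D).

Section restricted_image.
Local Open Scope ereal_scope.
Context d d' (T : measurableType d) (T' : measurableType d') (R : realType).
Variables (m : {finite_measure set T -> \bar R}) (E : set T) (h : T -> T').
Hypotheses (mE : measurable E) (mh : measurable_fun setT h).

Local Notation nu := (restr_image m mE mh).

Let restr_image0 : nu set0 = 0.
Proof. by rewrite /restr_image preimage_set0 setI0 measure0. Qed.

Let restr_image_ge0 D : 0 <= nu D.
Proof. exact: measure_ge0. Qed.

Let restr_image_sigma_additive : semi_sigma_additive nu.
Proof.
move=> F mF tF mUF; rewrite /restr_image preimage_bigcup setI_bigcupr.
apply: measure_semi_sigma_additive.
- by move=> n; apply: measurableI => //; exact: measurable_preimage.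
- by apply: trivIset_setIl => i j _ _ [x [Fi Fj]]; apply: tF => //; exists (h x).
- rewrite -setI_bigcupr -preimage_bigcup.
  by apply: measurableI => //; exact: measurable_preimage.
Qed.

HB.instance Definition _ := isMeasure.Build _ _ _ nu
  restr_image0 restr_image_ge0 restr_image_sigma_additive.

Let restr_image_fin : fin_num_fun nu.
Proof.
by move=> D mD; apply: fin_num_measure; apply: measurableI => //;
   exact: measurable_preimage.
Qed.

HB.instance Definition _ := Measure_isFinite.Build _ _ _ nu restr_image_fin.

End restricted_image.

Lemma measure_countable_fibers d (T : measurableType d) (R : realType)
    (m : {measure set T -> \bar R}) (K : countType) (h : T -> K) (S : set K) :
  (forall k, measurable (h @^-1` [set k])) ->
  m (h @^-1` S) = (\esum_(k in S) m (h @^-1` [set k]))%E.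
Proof.
move=> mh.
have hS : h @^-1` S = \bigcup_(n in pickle @` S) (pickle \o h) @^-1` [set n].
  apply/seteqP; split => [x Sx|x [_ [k Sk <-]] /= /(pcan_inj pickleK) -> //].
  by exists (pickle (h x)) => //; exists (h x).
have mF (n : nat) : measurable ((pickle \o h) @^-1` [set n]).
  case E : (unpickle n : option K) => [k|].
  - have [kn|kn] := eqVneq (pickle k) n.
      rewrite (_ : _ @^-1` _ = h @^-1` [set k]) //.
      apply/seteqP; split => x /=; rewrite -kn; last by move=> ->.
      by move/(pcan_inj pickleK).
    rewrite (_ : _ @^-1` _ = set0) //.
    apply/seteqP; split => x //= xn; move: E kn; rewrite -xn pickleK.
    by case=> ->; rewrite eqxx.
  - rewrite (_ : _ @^-1` _ = set0) //.
    by apply/seteqP; split => x //= xn; move: E; rewrite -xn pickleK.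
rewrite hS measure_bigcup //; last exact: trivIset_preimage1.
rewrite nneseries_esum// set_mem_set.
rewrite (@reindex_esum _ _ _ S _ pickle).
- apply: eq_esum => k Sk; congr (m _); apply/seteqP.
  by split => x /= => [/(pcan_inj pickleK)|->].
- by split; [move=> k Sk; exists k|move=> ? ? _ _; exact: (pcan_inj pickleK)|].
Qed.

Lemma eq_measure_fibers d (T : measurableType d) (R : realType)
    (m1 m2 : {measure set T -> \bar R}) (K : countType) (h : T -> K) (S : set K) :
  (forall k, measurable (h @^-1` [set k])) ->
  (forall k, m1 (h @^-1` [set k]) = m2 (h @^-1` [set k])) ->
  m1 (h @^-1` S) = m2 (h @^-1` S).
Proof.
by move=> mh m12; rewrite !measure_countable_fibers//; exact: eq_esum.
Qed.

Section densities.
Local Open Scope ereal_scope.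
Context d (W : measurableType d) (R : realType).
Implicit Types (p nu : {finite_measure set W -> \bar R}) (u : W -> R).

Definition is_density (p nu : set W -> \bar R) u :=
  [/\ measurable_fun setT u, (forall z, (0 <= u z)%R) &
      forall D, measurable D -> nu D = \int[p]_(z in D) (u z)%:E].

(** Setwise domination gives absolute continuity, hence a Radon-Nikodym
    derivative; its values are finite and may be read as reals. *)
Lemma density_exists p nu :
  (forall D, measurable D -> nu D <= p D) -> exists u, is_density p nu u.
Proof.
move=> nup.
have dom : nu `<< p.
  apply/null_content_dominatesP => D mD pD0.
  by apply/eqP; rewrite eq_le measure_ge0 andbT -pD0 nup.
have [f [f0 ffin fi fE]] := radon_nikodym_sigma_finite dom.
exists (fine \o f); split.
- by apply: measurableT_comp => //; exact: measurable_int fi.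
- by move=> z; exact: fine_ge0.
- move=> D mD; rewrite fE//; apply: eq_integral => z _ /=.
  by rewrite fineK.
Qed.

(** Change of measure, valid for every density: two densities agree p-almost
    everywhere, so it is enough to treat one of them. *)
Lemma integral_density p nu u (v : W -> \bar R) :
  is_density p nu u -> measurable_fun setT v -> (forall z, 0 <= v z) ->
  \int[p]_z (v z * (u z)%:E) = \int[nu]_z v z.
Proof.
move=> [mu u0 uE] mv v0.
have dom : nu `<< p.
  apply/null_content_dominatesP => D mD pD0.
  by rewrite uE// null_set_integral//; exact/measurable_EFinP/measurable_funTS.
rewrite -(Radon_Nikodym_SigmaFinite.change_of_variables dom)//.
have := Radon_Nikodym_SigmaFinite.f_integrable dom.
set f := Radon_Nikodym_SigmaFinite.f _ _ => fi.
apply: ae_eq_integral => //.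
- by apply: emeasurable_funM => //; exact/measurable_EFinP.
- by apply: emeasurable_funM => //; exact: measurable_int fi.
- apply: ae_eqe_mul2l; apply: ae_eq_sym; apply: integral_ae_eq => //.
    exact/measurable_EFinP.
  by move=> D _ mD; rewrite -uE// -Radon_Nikodym_SigmaFinite.f_integral.
Qed.

End densities.

Lemma density_indic d (T : measurableType d) (R : realType)
    (m : {finite_measure set T -> \bar R}) (E : set T) (mE : measurable E) :
  is_density m (mrestr m mE) (\1_E : T -> R).
Proof.
by split => // D mD; rewrite integral_indic// /mrestr setIC.
Qed.

Lemma integral_restr_image d d' (T : measurableType d) (T' : measurableType d')
    (R : realType) (m : {finite_measure set T -> \bar R}) (E : set T) (h : T -> T')
    (mE : measurable E) (mh : measurable_fun setT h) (v : T' -> \bar R) :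
  measurable_fun setT v -> (forall z, 0 <= v z)%E ->
  (\int[restr_image m mE mh]_z v z = \int[m]_(x in E) v (h x))%E.
Proof.
move=> mv v0.
rewrite (eq_measure_integral (pushforward (mrestr m mE) h)); last first.
  by move=> D mD _; exact: (congr1 m (setIC _ _)).
rewrite ge0_integral_pushforward// preimage_setT.
rewrite -(integral_density (density_indic m mE))//; last 2 first.
- exact: measurableT_comp.
- by move=> x /=.
rewrite [RHS]integral_mkcond; apply: eq_integral => x _.
rewrite patchE indicE /=; case: ifPn => _; first by rewrite mule1.
by rewrite mule0.
Qed.

(** The finiteness proof is an argument so that the finite measure structure can
    be inferred. *)
Definition density_measure d (T : measurableType d) (R : realType) (m : set T -> \bar R)
  (g : T -> \bar R) (mg : measurable_fun setT g) (g0 : forall x, (0 <= g x)%E)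
  (gfin : (\int[m]_x g x < +oo)%E) (E : set T) := (\int[m]_(x in E) g x)%E.

Section density_measure.
Local Open Scope ereal_scope.
Context d (T : measurableType d) (R : realType) (m : {measure set T -> \bar R}).
Variables (g : T -> \bar R) (mg : measurable_fun setT g) (g0 : forall x, 0 <= g x).
Hypothesis gfin : \int[m]_x g x < +oo.

Let density_measure0 : density_measure mg g0 gfin set0 = 0.
Proof. exact: integral_set0. Qed.

Let density_measure_ge0 E : 0 <= density_measure mg g0 gfin E.
Proof. by apply: integral_ge0 => x _. Qed.

Let density_measure_sigma_additive : semi_sigma_additive (density_measure mg g0 gfin).
Proof.
move=> F mF tF mUF; rewrite /density_measure; apply: cvg_toP.
  apply: ereal_nondecreasing_is_cvgn => i n ni.
  by apply: lee_sum_nneg_natr => // k _ _; exact: integral_ge0.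
by rewrite ge0_integral_bigcup//; exact: measurable_funTS.
Qed.

HB.instance Definition _ := isMeasure.Build _ _ _ (density_measure mg g0 gfin)
  density_measure0 density_measure_ge0 density_measure_sigma_additive.

Let density_measure_fin : fin_num_fun (density_measure mg g0 gfin).
Proof.
move=> D mD; rewrite ge0_fin_numE// (le_lt_trans _ gfin)//.
by apply: ge0_subset_integral.
Qed.

HB.instance Definition _ := Measure_isFinite.Build _ _ _ (density_measure mg g0 gfin)
  density_measure_fin.

End density_measure.

(** * Path spaces and finite-dimensional sets *)

(** The point [a0] is what makes the type of paths pointed, as a measurable type
    has to be. *)
Definition pathT (A : countType) (a0 : A) : Type := int -> A.

Section path_space.
Context (A : countType) (a0 : A).

HB.instance Definition _ := gen_eqMixin (pathT a0).
HB.instance Definition _ := gen_choiceMixin (pathT a0).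
HB.instance Definition _ := isPointed.Build (pathT a0) (fun=> a0).

Let path_measurable0 : path_measurable A set0.
Proof. exact: sigma_algebra0. Qed.

Let path_measurableC E : path_measurable A E -> path_measurable A (~` E).
Proof. by move=> mE; rewrite -setTD; exact: sigma_algebraCD. Qed.

HB.instance Definition _ :=
  @isMeasurable.Build (sigma_display (path_measurable A)) (pathT a0)
  (path_measurable A : set (set (pathT a0))) path_measurable0 path_measurableC
  (@sigma_algebra_bigcup _ setT _).

Lemma measurable_coord t (S : set A) :
  measurable ([set x | S (x t)] : set (pathT a0)).
Proof. by apply: sub_sigma_algebra; exists t, S. Qed.

Lemma measurable_into_path d (T : measurableType d) (h : T -> pathT a0) :
  (forall t (S : set A), measurable [set w | S (h w t)]) ->
  measurable_fun setT h.
Proof.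
move=> mh; apply: measurability => // _ [_ [t [S ->]] <-].
by rewrite setTI; exact: mh.
Qed.

(** The events with such an [r] are stable under intersection and generate the
    path events; unlike the cylinders, they are also stable under preimage by
    the freezing maps [lstop] and [rstop] below, which only changes the times. *)
Definition depends_on (r : seq int) (D : set (int -> A)) :=
  forall x y : int -> A, {in r, x =1 y} -> D x -> D y.

Definition cylinder (r : seq int) (s : int -> A) : set (int -> A) :=
  [set x : int -> A | {in r, x =1 s}].

Lemma depends_on_cylinder r s : depends_on r (cylinder r s).
Proof. by move=> x y xy xs t tr; rewrite -xy//; exact: xs. Qed.

Lemma depends_on_sub (r r' : seq int) D : {subset r <= r'} -> depends_on r D -> depends_on r' D.
Proof. by move=> rr' rD x y xy; apply: rD => t tr; exact/xy/rr'. Qed.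

Lemma depends_on_coord t (S : set A) : depends_on [:: t] [set x | S (x t)].
Proof. by move=> x y xy /=; rewrite xy ?inE. Qed.

Lemma depends_on_setI r r' D D' : depends_on r D -> depends_on r' D' -> depends_on (r ++ r') (D `&` D').
Proof.
move=> rD rD' x y xy [Dx D'x]; split.
  by apply: rD Dx => t tr; apply: xy; rewrite mem_cat tr.
by apply: rD' D'x => t tr; apply: xy; rewrite mem_cat tr orbT.
Qed.

Lemma depends_on_preimage r D : depends_on r D ->
  D = (fun x => map x r) @^-1` [set k | exists2 x, D x & map x r = k].
Proof.
move=> rD; apply/seteqP; split=> [x Dx|x [y Dy /eq_in_map xy]]; first by exists x.
exact: rD xy Dy.
Qed.

Lemma fiber_cylinder r (k : seq A) :
  (fun x : int -> A => map x r) @^-1` [set k] = set0 \/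
  exists s, (fun x : int -> A => map x r) @^-1` [set k] = cylinder r s.
Proof.
have [[s sk]|nsk] := pselect (exists s : int -> A, map s r = k).
  right; exists s; rewrite -sk; apply/seteqP.
  by split => x /eq_in_map.
by left; apply/seteqP; split => x // xk; apply: nsk; exists x.
Qed.

Lemma measurable_cylinder r s : measurable (cylinder r s : set (pathT a0)).
Proof.
elim: r => [|t r IH].
  by rewrite (_ : cylinder _ _ = setT)//; apply/seteqP; split.
rewrite (_ : cylinder _ _ = [set x | x t = s t] `&` cylinder r s).
  by apply: measurableI => //; exact: (measurable_coord t [set s t]).
apply/seteqP; split => [x xs|x [xt xs] u].
  by split; [apply: xs; rewrite inE eqxx|move=> u ur; apply: xs; rewrite inE ur orbT].
by rewrite inE => /orP[/eqP ->|]; [|exact: xs].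
Qed.

Lemma measurable_fiber r (k : seq A) :
  measurable ((fun x : pathT a0 => map x r) @^-1` [set k]).
Proof.
by have [->|[s ->]] := fiber_cylinder r k; [exact: measurable0|exact: measurable_cylinder].
Qed.

Lemma measurable_depends_on r D : depends_on r D -> measurable (D : set (pathT a0)).
Proof.
move=> /depends_on_preimage ->.
set S := [set k | _].
rewrite (_ : _ @^-1` S =
  \bigcup_(k in S) ((fun x : pathT a0 => map x r) @^-1` [set k])); last first.
  by apply/seteqP; split => [x Sx|x [k Sk /= ->]//]; exists (map x r).
have -> : \bigcup_(k in S) ((fun x : pathT a0 => map x r) @^-1` [set k]) =
  \bigcup_k (if k \in S then (fun x : pathT a0 => map x r) @^-1` [set k] else set0).
  by rewrite bigcup_mkcond.
apply: countable_bigcupT_measurable => // k.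
by case: ifPn => // _; exact: measurable_fiber.
Qed.

Section uniqueness.
Context (R : realType).
Variables m1 m2 : {finite_measure set (pathT a0) -> \bar R}.

Lemma eq_measure_depends_on r : (forall s, m1 (cylinder r s) = m2 (cylinder r s)) ->
  forall D, depends_on r D -> m1 D = m2 D.
Proof.
move=> m12 D /depends_on_preimage ->.
apply: eq_measure_fibers => k; first exact: measurable_fiber.
by have [->|[s ->]] := fiber_cylinder r k; [rewrite !measure0|exact: m12].
Qed.

(** Dynkin's argument: these events are stable under intersection and generate. *)
Lemma eq_measure_path : (forall r D, depends_on r D -> m1 D = m2 D) ->
  forall D, measurable D -> m1 D = m2 D.
Proof.
move=> m12 D mD.
pose G : set (set (pathT a0)) := [set D | exists r, depends_on r D].
apply: (measure_unique G (fun=> setT)) => //.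
- apply/seteqP; split; apply: smallest_sub; try exact: smallest_sigma_algebra.
  + move=> _ [t [S ->]]; apply: sub_sigma_algebra.
    by exists [:: t]; exact: depends_on_coord.
  + by move=> E [r rE]; exact: measurable_depends_on rE.
- by move=> E F [r rE] [r' rF]; exists (r ++ r'); exact: depends_on_setI.
- by move=> _; exists [::].
- exact: bigcup_const.
- by move=> E [r rE]; exact: m12 rE.
- by move=> k; rewrite ltey_eq fin_num_measure.
Qed.

End uniqueness.
End path_space.

(** * Random sequences with prescribed prefix probabilities *)

(** Prefixes of a sequence are listed with the latest entry first, so that
    appending an entry is [cons]. *)
Fixpoint rprefix (K : Type) (x : nat -> K) (n : nat) : seq K :=
  if n is n'.+1 then x n' :: rprefix x n' else [::].

Lemma size_rprefix (K : Type) (x : nat -> K) n : size (rprefix x n) = n.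
Proof. by elim: n => //= n ->. Qed.

Lemma eq_rprefix (K : Type) (x y : nat -> K) n :
  rprefix x n = rprefix y n <-> forall i, (i < n)%N -> x i = y i.
Proof.
elim: n => [|n IH] /=; first by split.
split => [[xy /IH xyn] i|xy].
  by rewrite ltnS leq_eqVlt => /orP[/eqP -> //|/xyn].
by rewrite xy// (IH.2 _)// => i ni; apply: xy; rewrite ltnS ltnW.
Qed.

(** Kolmogorov extension for a countable alphabet. The value [p s] is the
    prescribed probability of the prefix [s] (latest letter first), and
    [p_cons] is consistency. The prefix is given a half-open subinterval of
    the unit interval of length [p s], cut into consecutive slots for its one-letter
    extensions, in the order of their codes; the process reads off the slots
    containing a uniform point. *)
Section sequence_space.
Context (R : realType) (K : countType) (k0 : K).
Variable p : seq K -> R.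
Hypothesis p_ge0 : forall s, 0 <= p s.
Hypothesis p_nil : p [::] = 1.
Hypothesis p_cons : forall s,
  (\esum_(k in [set: K]) (p (k :: s))%:E = (p s)%:E)%E.

(** The weights of the extensions of [s], indexed by codes, with weight zero for
    the integers that code no letter. *)
Let w s (j : nat) : R := if @pickle_inv K j is Some k then p (k :: s) else 0.

Let w_ge0 s j : 0 <= w s j.
Proof. by rewrite /w; case: pickle_inv. Qed.

Let w_sum s : (\sum_(j <oo) (w s j)%:E = (p s)%:E)%E.
Proof.
rewrite nneseries_esumT; last by move=> j; rewrite lee_fin.
rewrite -p_cons (esumID (range (@pickle K))); last by move=> j _; rewrite lee_fin.
rewrite [X in (_ + X)%E]esum1 ?adde0; last first.
  move=> j [_ nj]; rewrite /w; case E : pickle_inv => [k|//].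
  by case: nj; exists k => //; have := @pickle_invK K j; rewrite E.
rewrite setTI (@reindex_esum _ K _ setT _ (@pickle K)).
  by apply: eq_esum => k _; rewrite /w pickleK_inv.
by split; [move=> k Sk; exists k|move=> ? ? _ _; exact: (pcan_inj pickleK)|].
Qed.

Fixpoint slot_start (s : seq K) : R :=
  if s is k :: s' then slot_start s' + \sum_(j < pickle k) w s' j else 0.

Definition slot s : set R := [set` `[slot_start s, slot_start s + p s[ ].

Let slotP s u : slot s u <-> slot_start s <= u /\ u < slot_start s + p s.
Proof. by rewrite /slot/= in_itv /=; split => [/andP[]|[-> ->]]. Qed.

Let w_pickle s k : w s (pickle k) = p (k :: s).
Proof. by rewrite /w pickleK_inv. Qed.

Let slot_consP k s u : slot (k :: s) u <->
  slot_start s + \sum_(j < pickle k) w s j <= u /\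
  u < slot_start s + \sum_(j < (pickle k).+1) w s j.
Proof. by rewrite slotP /= big_ord_recr /= w_pickle addrA. Qed.

Let sum_w_le s m n : (m <= n)%N -> \sum_(j < m) w s j <= \sum_(j < n) w s j.
Proof.
move=> mn; rewrite -!(big_mkord xpredT (w s)) (@big_cat_nat _ _ _ m 0 n)//=.
by rewrite lerDl sumr_ge0.
Qed.

Let sum_w_lep s n : \sum_(j < n) w s j <= p s.
Proof.
rewrite -lee_fin -w_sum -(big_mkord xpredT (w s)) -sumEFin.
by apply: nneseries_lim_ge => j _; rewrite lee_fin.
Qed.

Let slot_sub k s : slot (k :: s) `<=` slot s.
Proof.
move=> u /slot_consP[ku uk]; apply/slotP; split.
  by apply: le_trans ku; rewrite lerDl sumr_ge0.
by apply: lt_le_trans uk _; rewrite lerD2l.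
Qed.

Let slot_inj k k' s u : slot (k :: s) u -> slot (k' :: s) u -> k = k'.
Proof.
wlog le : k k' / (pickle k <= pickle k')%N.
  by move=> H a b; case/orP: (leq_total (pickle k) (pickle k')) =>
    [/H/(_ a b)//|/H/(_ b a) ->].
move: le; rewrite leq_eqVlt => /orP[/eqP/(pcan_inj pickleK)//|lt].
move=> /slot_consP[_ uk] /slot_consP[ku _]; exfalso.
have := sum_w_le s lt; lra.
Qed.

Let slot_split s u : slot s u -> exists k, slot (k :: s) u.
Proof.
move=> /slotP[su us].
have [j0 uj0] : exists j, u < slot_start s + \sum_(i < j) w s i.
  apply: contrapT => /forallNP nu.
  (* Otherwise all partial sums, hence [p s], are at most [u - slot_start s]. *)
  have : ((p s)%:E <= (u - slot_start s)%:E)%E.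
    rewrite -w_sum; apply: lime_le.
      by apply: is_cvg_nneseries => j _ _; rewrite lee_fin.
    near=> n; rewrite sumEFin lee_fin big_mkord.
    by have /negP := nu n; rewrite -leNgt; lra.
  by rewrite lee_fin; lra.
have [j uj jmin] := ex_minnP (ex_intro (fun j => u < slot_start s + \sum_(i < j) w s i) j0 uj0).
case: j uj jmin => [|j] uj jmin.
  by move: uj; rewrite big_ord0 addr0 ltNge su.
have ju : slot_start s + \sum_(i < j) w s i <= u.
  by rewrite leNgt; apply/negP => /jmin; rewrite ltnn.
(* The first slot ending beyond [u] is nonempty, so its index is a code. *)
case E : (@pickle_inv K j) => [k|]; last first.
  by move: uj; rewrite big_ord_recr /= {2}/w E addr0 ltNge ju.
exists k; apply/slot_consP.
by have := @pickle_invK K j; rewrite E /= => ->.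
Unshelve. all: by end_near. Qed.

Fixpoint history (u : R) (n : nat) : seq K :=
  if n is n'.+1 then xget k0 [set k | slot (k :: history u n') u] :: history u n'
  else [::].

Definition coordinate (n : nat) (u : R) : K := head k0 (history u n.+1).

Let slot_nil : slot [::] = [set` `[0, 1[ ].
Proof. by rewrite /slot /= p_nil add0r. Qed.

Let size_history u n : size (history u n) = n.
Proof. by elim: n => //= n ->. Qed.

Let slot_history u n : slot [::] u -> slot (history u n) u.
Proof.
move=> u01; elim: n => // n IH /=; case: xgetP => [k _ //|].
by have [k ku] := slot_split IH; move=> /(_ k).
Qed.

Let history_slot s u : slot s u -> history u (size s) = s.
Proof.
elim: s => //= k s IH ksu; rewrite IH; last exact: slot_sub ksu.
by congr cons; apply: xget_unique => // k' k'u; exact: slot_inj k'u ksu.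
Qed.

Let slot_sub01 s : slot s `<=` slot [::].
Proof. by elim: s => // k s IH; exact: subset_trans (@slot_sub k s) IH. Qed.

(** The points outside the unit interval are the only obstacle to the equality of
    a fibre of [history] and a slot; they form a null set. *)
Let history_out u n : ~ slot [::] u -> history u n = nseq n k0.
Proof.
move=> nu; elim: n => //= n ->; congr cons.
by apply: xgetPN => k ku; apply: nu; exact: slot_sub01 ku.
Qed.

Let history_fiber s : (history^~ (size s)) @^-1` [set s] =
  slot s `|` (~` slot [::] `&` [set _ | s = nseq (size s) k0]).
Proof.
apply/seteqP; split => [u /= us|u [/history_slot//|[nu /= snk]]].
  have [u01|u01] := pselect (slot [::] u).
    by left; rewrite -us; exact: slot_history.
  by right; split => //; rewrite -[in LHS]us; exact: history_out.
by rewrite history_out.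
Qed.

Let measurable_outside s :
  measurable (~` slot [::] `&` [set _ | s = nseq (size s) k0]).
Proof.
apply: measurableI; first by apply: measurableC; exact: measurable_itv.
have [e|ne] := pselect (s = nseq (size s) k0).
  by rewrite (_ : [set _ | _] = setT)//; apply/seteqP; split.
by rewrite (_ : [set _ | _] = set0)//; apply/seteqP; split.
Qed.

Let measurable_history n s : measurable ((history^~ n) @^-1` [set s]).
Proof.
have [<-|ns] := eqVneq (size s) n.
  rewrite history_fiber; apply: measurableU; first exact: measurable_itv.
  exact: measurable_outside.
rewrite (_ : _ @^-1` _ = set0)//; apply/seteqP; split => // u /= us.
by move: ns; rewrite -us size_history eqxx.
Qed.

Lemma measurable_coordinate n (S : set K) : measurable (coordinate n @^-1` S).
Proof.
rewrite (_ : _ @^-1` _ = \bigcup_(s in [set s | S (head k0 s)])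
  (history^~ n.+1) @^-1` [set s]); last first.
  by apply/seteqP; split => [u Su|u [s Ss us]]; [exists (history u n.+1)|
    rewrite -us in Ss].
rewrite bigcup_mkcond; apply: countable_bigcupT_measurable => // s.
by case: ifPn => // _; exact: measurable_history.
Qed.

Let history_coordinate u n : history u n = rprefix (coordinate^~ u) n.
Proof. by elim: n => // n IH; rewrite [RHS]/= -IH. Qed.

Let slot_prob s :
  uniform_prob (@ltr01 R) (slot s) = (p s)%:E.
Proof.
rewrite /uniform_prob (eq_integral (cst 1%E)); last first.
  move=> u; rewrite inE => /slot_sub01; rewrite slot_nil /= in_itv/= => /andP[u0 u1].
  by rewrite /uniform_pdf u0 (ltW u1) subr0 invr1.
rewrite integral_cst; last exact: measurable_itv.
rewrite mul1e; etransitivity; first exact: lebesgue_measure_itv.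
rewrite /= lte_fin ltrDl.
case: ltP => p0; first by rewrite -EFinB addrAC subrr add0r.
by congr EFin; apply/eqP; rewrite eq_le p0 p_ge0.
Qed.

Lemma sequence_space : exists xi : nat -> R -> K,
  (forall n (S : set K), measurable (xi n @^-1` S)) /\
  forall x n, uniform_prob (@ltr01 R)
    [set u | forall i, (i < n)%N -> xi i u = x i] = (p (rprefix x n))%:E.
Proof.
exists coordinate; split; first exact: measurable_coordinate.
move=> x n; set s := rprefix x n.
have -> : [set u | forall i, (i < n)%N -> coordinate i u = x i] =
    (history^~ (size s)) @^-1` [set s].
  apply/seteqP; split => u /=; rewrite size_rprefix history_coordinate;
    by move/eq_rprefix.
rewrite -(slot_prob s); apply/eqP; rewrite eq_le; apply/andP; split; last first.
  apply: le_measure; rewrite ?inE.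
  - exact: measurable_itv.
  - exact: measurable_history.
  - by rewrite history_fiber; exact: subsetUl.
have out0 : uniform_prob (@ltr01 R) (~` slot [::]) = 0%E.
  rewrite probability_setC; last exact: measurable_itv.
  by rewrite [X in (1 - X)%E](slot_prob [::]) p_nil subee.
rewrite history_fiber; apply: le_trans (measureU2 _ _ _) _.
- exact: measurable_itv.
- exact: measurable_outside.
- rewrite -[leRHS]adde0; apply: leeD => //.
  rewrite -out0; apply: le_measure; last exact: subIsetl.
  all: rewrite inE.
  + exact: measurable_outside.
  + by apply: measurableC; exact: measurable_itv.
Qed.

End sequence_space.

(** * Conditional densities and the relative product *)

Section conditional_density.
Local Open Scope ereal_scope.
Context d d' (S : measurableType d) (W : measurableType d') (R : realType).
Context (P : probability S R) (al : S -> W) (p : probability W R).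
Hypothesis mal : measurable_fun setT al.
Hypothesis law : forall D, measurable D -> P (al @^-1` D) = p D.

Definition is_cond_density (E : set S) : (W -> R) -> Prop :=
  is_density p (fun D => P (E `&` al @^-1` D)).

Lemma is_cond_density_exists E : measurable E -> exists u, is_cond_density E u.
Proof.
move=> mE; apply: (@density_exists _ _ _ p (restr_image P mE mal)) => D mD.
change (P (E `&` al @^-1` D) <= p D); rewrite -law//; apply: le_measure; rewrite ?inE.
- by apply: measurableI => //; exact: measurable_preimage.
- exact: measurable_preimage.
- exact: subIsetr.
Qed.

(** A fixed choice of density, so that [relprod] below is a function of events. *)
Definition cond_density (E : set S) : W -> R := xget (cst 0%R) (is_cond_density E).

Lemma cond_densityP E : measurable E -> is_cond_density E (cond_density E).
Proof.
by move=> /is_cond_density_exists [u uE]; rewrite /cond_density; case: xgetP => [v _//|/(_ u)].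
Qed.

Lemma cond_density_ge0 E z : (0 <= cond_density E z)%R.
Proof. by rewrite /cond_density; case: xgetP => [v _ [_ + _]|]. Qed.

(** The defining property of conditional expectation, extended from indicators to
    nonnegative functions of the conditioning variable. *)
Lemma integral_cond_density E u (v : W -> \bar R) : measurable E -> is_cond_density E u ->
  measurable_fun setT v -> (forall z, 0 <= v z) ->
  \int[p]_z (v z * (u z)%:E) = \int[P]_(x in E) v (al x).
Proof.
move=> mE uE mv v0.
rewrite (@integral_density _ _ _ p (restr_image P mE mal))//.
exact: integral_restr_image.
Qed.

Lemma is_cond_densityT : is_cond_density setT (cst 1%R).
Proof.
split=> [|z|D mD]; [exact: measurable_cst|exact: ler01|].
by rewrite setTI law// (integral_cst _ _ 1)// mul1e.
Qed.

(** An event about the conditioning variable comes out of a conditional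
    probability. *)
Lemma is_cond_density_setI E u D : measurable E -> measurable D -> is_cond_density E u ->
  is_cond_density (E `&` al @^-1` D) (fun z => (\1_D z * u z)%R).
Proof.
move=> mE mD [mu u0 uE]; split.
- exact: measurable_funM.
- by move=> z; rewrite mulr_ge0.
- move=> D' mD'; rewrite -setIA -preimage_setI uE; last exact: measurableI.
  rewrite setIC integral_mkcondr; apply: eq_integral => z _.
  rewrite patchE indicE; case: ifPn => _; rewrite ?mul1r ?mul0r//.
Qed.

End conditional_density.

Section relative_product.
Local Open Scope ereal_scope.
Context d1 d2 d (S1 : measurableType d1) (S2 : measurableType d2)
  (W : measurableType d) (R : realType).
Context (P1 : probability S1 R) (P2 : probability S2 R) (p : probability W R).
Context (al : S1 -> W) (be : S2 -> W).
Hypothesis mal : measurable_fun setT al.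
Hypothesis mbe : measurable_fun setT be.
Hypothesis law1 : forall D, measurable D -> P1 (al @^-1` D) = p D.
Hypothesis law2 : forall D, measurable D -> P2 (be @^-1` D) = p D.

Local Notation u1 := (cond_density P1 al p).
Local Notation u2 := (cond_density P2 be p).

(** The mass that the relatively independent joining of [P1] and [P2] over [p]
    gives to the rectangle with sides [E] and [F]. *)
Definition relprod (E : set S1) (F : set S2) : \bar R :=
  \int[p]_z (u1 E z * u2 F z)%:E.

Local Notation J := relprod.

Let mu1 E : measurable E -> measurable_fun setT (u1 E).
Proof. by move=> mE; have [] := cond_densityP mal law1 mE. Qed.

Let mu2 F : measurable F -> measurable_fun setT (u2 F).
Proof. by move=> mF; have [] := cond_densityP mbe law2 mF. Qed.

(** By [integral_cond_density] the integral of a product of densities can be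
    transferred to [P1], where only the second density is visible, or to [P2],
    where only the first is. Replacing one density at a time shows that the
    choice does not matter. *)
Lemma relprod_density E F u v : measurable E -> measurable F ->
  is_cond_density P1 al p E u -> is_cond_density P2 be p F v ->
  J E F = \int[p]_z (u z * v z)%:E.
Proof.
move=> mE mF uE vF.
have [mu u0 _] := uE; have [mv v0 _] := vF.
transitivity (\int[p]_z ((u2 F z)%:E * (u1 E z)%:E)).
  by apply: eq_integral => z _; rewrite muleC EFinM.
have ge2 z : 0 <= (u2 F z)%:E by rewrite lee_fin cond_density_ge0.
have m2 : measurable_fun setT (fun z => (u2 F z)%:E).
  by apply/measurable_EFinP; exact: mu2.
rewrite (integral_cond_density mal mE (cond_densityP mal law1 mE))//.
rewrite -(integral_cond_density mal mE uE m2 ge2).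
transitivity (\int[p]_z ((u z)%:E * (u2 F z)%:E)).
  by apply: eq_integral => z _; rewrite muleC.
have geu z : 0 <= (u z)%:E by rewrite lee_fin.
have meu : measurable_fun setT (fun z => (u z)%:E) by apply/measurable_EFinP.
rewrite (integral_cond_density mbe mF (cond_densityP mbe law2 mF))//.
by rewrite -(integral_cond_density mbe mF vF meu geu).
Qed.

Lemma relprod_setTl F : measurable F -> J setT F = P2 F.
Proof.
move=> mF; have uF := cond_densityP mbe law2 mF.
rewrite (relprod_density measurableT mF (is_cond_densityT law1) uF).
rewrite -[F in RHS]setIT; have [_ _ /(_ setT measurableT)] := uF.
rewrite preimage_setT => ->.
by apply: eq_integral => z _; rewrite mul1r.
Qed.

Lemma relprod_setTr E : measurable E -> J E setT = P1 E.
Proof.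
move=> mE; have uE := cond_densityP mal law1 mE.
rewrite (relprod_density mE measurableT uE (is_cond_densityT law2)).
rewrite -[E in RHS]setIT; have [_ _ /(_ setT measurableT)] := uE.
rewrite preimage_setT => ->.
by apply: eq_integral => z _; rewrite mulr1.
Qed.

(** Both sides see the same conditioning variable: the joining charges only pairs
    with equal images. *)
Lemma relprod_setI E F D D' : measurable E -> measurable F ->
  measurable D -> measurable D' ->
  J (E `&` al @^-1` D) (F `&` be @^-1` D') =
  \int[p]_(z in D `&` D') (u1 E z * u2 F z)%:E.
Proof.
move=> mE mF mD mD'.
rewrite (relprod_density _ _ (is_cond_density_setI mE mD (cond_densityP mal law1 mE))
  (is_cond_density_setI mF mD' (cond_densityP mbe law2 mF))); last 2 first.
- by apply: measurableI => //; exact: measurable_preimage.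
- by apply: measurableI => //; exact: measurable_preimage.
rewrite [RHS]integral_mkcond; apply: eq_integral => z _.
rewrite patchE in_setI !indicE.
by case: (z \in D); case: (z \in D'); rewrite /= ?mul1r ?mul0r ?mulr0.
Qed.

Lemma relprod_ge0 E F : 0 <= J E F.
Proof.
by apply: integral_ge0 => z _; rewrite lee_fin mulr_ge0// cond_density_ge0.
Qed.

(** As an integral over [E], the joining is manifestly a measure in [E]. *)
Lemma relprod_integrall E F : measurable E -> measurable F ->
  J E F = \int[P1]_(x in E) (u2 F (al x))%:E.
Proof.
move=> mE mF.
rewrite -(integral_cond_density mal mE (cond_densityP mal law1 mE) (v := EFin \o u2 F)).
- by apply: eq_integral => z _; rewrite /= muleC EFinM.
- by apply/measurable_EFinP; exact: mu2.
- by move=> z; rewrite lee_fin cond_density_ge0.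
Qed.

Lemma relprod_integralr E F : measurable E -> measurable F ->
  J E F = \int[P2]_(y in F) (u1 E (be y))%:E.
Proof.
move=> mE mF.
rewrite -(integral_cond_density mbe mF (cond_densityP mbe law2 mF) (v := EFin \o u1 E)).
- by apply: eq_integral => z _; rewrite EFinM.
- by apply/measurable_EFinP; exact: mu1.
- by move=> z; rewrite lee_fin cond_density_ge0.
Qed.

Lemma relprod_measurel F : measurable F -> exists m : {finite_measure set S1 -> \bar R},
  forall E, measurable E -> m E = J E F.
Proof.
move=> mF.
have mg : measurable_fun setT (fun x => (u2 F (al x))%:E).
  by apply/measurable_EFinP; apply: measurableT_comp => //; exact: mu2.
have g0 x : 0 <= (u2 F (al x))%:E by rewrite lee_fin cond_density_ge0.
have gfin : \int[P1]_x (u2 F (al x))%:E < +oo.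
  by rewrite -relprod_integrall// relprod_setTl// ltey_eq fin_num_measure.
exists (density_measure mg g0 gfin) => E mE.
by rewrite relprod_integrall.
Qed.

Lemma relprod_measurer E : measurable E -> exists m : {finite_measure set S2 -> \bar R},
  forall F, measurable F -> m F = J E F.
Proof.
move=> mE.
have mg : measurable_fun setT (fun y => (u1 E (be y))%:E).
  by apply/measurable_EFinP; apply: measurableT_comp => //; exact: mu1.
have g0 y : 0 <= (u1 E (be y))%:E by rewrite lee_fin cond_density_ge0.
have gfin : \int[P2]_y (u1 E (be y))%:E < +oo.
  by rewrite -relprod_integralr// relprod_setTr// ltey_eq fin_num_measure.
exists (density_measure mg g0 gfin) => F mF.
by rewrite relprod_integralr.
Qed.

Lemma relprod_lel E F : measurable E -> measurable F -> J E F <= P1 E.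
Proof.
move=> mE mF; rewrite -relprod_setTr//.
have [m mJ] := relprod_measurer mE.
by rewrite -!mJ//; apply: le_measure; rewrite ?inE.
Qed.

Lemma relprod_ler E F : measurable E -> measurable F -> J E F <= P2 F.
Proof.
move=> mE mF; rewrite -relprod_setTl//.
have [m mJ] := relprod_measurel mF.
by rewrite -!mJ//; apply: le_measure; rewrite ?inE.
Qed.

Lemma relprod_fin E F : measurable E -> measurable F -> J E F \is a fin_num.
Proof.
by move=> mE mF; have [m mJ] := relprod_measurel mF; rewrite -mJ// fin_num_measure.
Qed.

End relative_product.

Section equivariance.
Local Open Scope ereal_scope.
Context d d' (S : measurableType d) (W : measurableType d') (R : realType).
Context (P : probability S R) (al : S -> W) (p : probability W R).
Context (sS : S -> S) (sW tW : W -> W).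
Hypothesis mal : measurable_fun setT al.
Hypothesis msS : measurable_fun setT sS.
Hypothesis msW : measurable_fun setT sW.
Hypothesis mtW : measurable_fun setT tW.
Hypothesis sWK : cancel sW tW.
Hypothesis al_s : forall x, al (sS x) = sW (al x).
Hypothesis P_inv : forall E, measurable E -> P (sS @^-1` E) = P E.
Hypothesis p_inv : forall D, measurable D -> p (sW @^-1` D) = p D.

(** Conditional probabilities commute with a symmetry of the whole situation.
    Invertibility of the symmetry on the base makes every event [D] there a
    preimage. *)
Lemma is_cond_density_equivariant E u : measurable E -> is_cond_density P al p E u ->
  is_cond_density P al p (sS @^-1` E) (u \o sW).
Proof.
move=> mE [mu u0 uE]; split => [|z|D mD]; [exact: measurableT_comp|exact: u0|].
have mD' : measurable (tW @^-1` D) by exact: measurable_preimage.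
have -> : D = sW @^-1` (tW @^-1` D).
  by apply/seteqP; split => z /=; rewrite sWK.
have -> : sS @^-1` E `&` al @^-1` (sW @^-1` (tW @^-1` D)) =
    sS @^-1` (E `&` al @^-1` (tW @^-1` D)).
  by apply/seteqP; split => x /=; rewrite al_s.
rewrite P_inv; last by apply: measurableI => //; exact: measurable_preimage.
rewrite uE//; transitivity (\int[pushforward p sW]_(z in tW @^-1` D) (u z)%:E).
  by apply: eq_measure_integral => D' mD'' _; rewrite -[LHS]p_inv.
rewrite ge0_integral_pushforward//.
- by apply/measurable_EFinP/measurable_funTS.
- by move=> z _; rewrite lee_fin.
Qed.

End equivariance.

(** * Splitting a Markov chain at a time *)

(** Freezing a path after, respectively before, time [t]: an event about the past
    (future) of [t] is a preimage under [lstop t] ([rstop t]). *)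
Definition lstop (A : Type) (t : int) (x : int -> A) : int -> A :=
  fun i => x (Num.min i t).
Definition rstop (A : Type) (t : int) (x : int -> A) : int -> A :=
  fun i => x (Num.max i t).
Definition at_time (A : Type) (t : int) (a : A) : set (int -> A) :=
  [set x | x t = a].

Section stopping.
Context (A : countType) (a0 : A).

Lemma measurable_lstop t : measurable_fun setT (lstop t : pathT a0 -> pathT a0).
Proof. by apply: measurable_into_path => i S; exact: measurable_coord. Qed.

Lemma measurable_rstop t : measurable_fun setT (rstop t : pathT a0 -> pathT a0).
Proof. by apply: measurable_into_path => i S; exact: measurable_coord. Qed.

Lemma measurable_at_time t a : measurable (at_time t a : set (pathT a0)).
Proof. exact: (measurable_coord a0 t [set a]). Qed.

Definition past_times (t : int) (n : nat) := [seq t - k%:Z | k <- iota 0 n.+1].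
Definition future_times (t : int) (n : nat) := [seq t + k%:Z | k <- iota 0 n.+1].

Lemma past_timesP t n i : reflect (t - n%:Z <= i <= t) (i \in past_times t n).
Proof.
apply: (iffP mapP) => [[k]|H].
  by rewrite mem_iota => kn ->; lia.
by exists `|t - i|%N; [rewrite mem_iota; lia|lia].
Qed.

Lemma future_timesP t n i : reflect (t <= i <= t + n%:Z) (i \in future_times t n).
Proof.
apply: (iffP mapP) => [[k]|H].
  by rewrite mem_iota => kn ->; lia.
by exists `|t - i|%N; [rewrite mem_iota; lia|lia].
Qed.

Lemma seq_int_bound (r : seq int) : exists n : nat, forall i, i \in r -> (`|i| <= n)%N.
Proof.
elim: r => [|i r [n rn]]; first by exists 0%N.
exists (maxn `|i| n)%N => j; rewrite inE => /orP[/eqP ->|/rn]; lia.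
Qed.

Lemma depends_on_lstop t r (D : set (int -> A)) : depends_on r D ->
  exists n, depends_on (past_times t n) (lstop t @^-1` D).
Proof.
move=> rD; have [n rn] := seq_int_bound r.
exists (n + `|t|)%N => x y xy; apply: rD => i /rn ir.
by apply: xy; apply/past_timesP; lia.
Qed.

Lemma depends_on_rstop t r (D : set (int -> A)) : depends_on r D ->
  exists n, depends_on (future_times t n) (rstop t @^-1` D).
Proof.
move=> rD; have [n rn] := seq_int_bound r.
exists (n + `|t|)%N => x y xy; apply: rD => i /rn ir.
by apply: xy; apply/future_timesP; lia.
Qed.

End stopping.

Section markov_splitting.
Local Open Scope ereal_scope.
Context (R : realType) (A : countType) (a0 : A).
Variable P : probability (pathT a0) R.

(** The Markov property in multiplicative form, which also makes sense, and is
    then trivial, when the past has probability zero. *)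
Definition markov_law := forall (t : int) (n : nat) (x : int -> A) (b : A),
  P (cylinder (past_times t n) x `&` at_time (t + 1)%R b) * P (at_time t (x t)) =
  P (cylinder (past_times t n) x) * P (at_time t (x t) `&` at_time (t + 1)%R b).

Hypothesis hP : markov_law.

Let nn (E : set (pathT a0)) : {nonneg R} := NngNum (fine_ge0 (measure_ge0 P E)).

Let nnE E : measurable E -> (nn E)%:num%:E = P E.
Proof. by move=> mE; rewrite /= fineK// fin_num_measure. Qed.

Let mat t a : measurable (at_time t a : set (pathT a0)) := measurable_at_time a0 t a.

Let mid : measurable_fun setT (id : pathT a0 -> pathT a0).
Proof. exact: measurable_id. Qed.

Let mlstop t (E : set (pathT a0)) : measurable E -> measurable (lstop t @^-1` E : set (pathT a0)).
Proof. by move=> mE; apply: (measurable_preimage (@measurable_lstop A a0 t)). Qed.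

(** The Markov property for arbitrary past events. As functions of the past event
    both sides are multiples of finite measures, so past cylinders suffice; a
    cylinder that is inconsistent with the state at time [t] contributes zero. *)
Let step t a b (E : set (pathT a0)) : measurable E ->
  P (lstop t @^-1` E `&` (at_time t a `&` at_time (t + 1)%R b)) * P (at_time t a) =
  P (lstop t @^-1` E `&` at_time t a) * P (at_time t a `&` at_time (t + 1)%R b).
Proof.
set H := at_time t a; set H' := at_time (t + 1)%R b => mE.
have mH : measurable (H : set (pathT a0)) by exact: mat.
have mHH' : measurable (H `&` H' : set (pathT a0)) by apply: measurableI; exact: mat.
rewrite [LHS]muleC [RHS]muleC -(nnE mH) -(nnE mHH').
rewrite ![lstop t @^-1` E `&` _]setIC.
pose m1 (f : pathT a0 -> pathT a0) mf :=
  mscale (nn H) (restr_image P mHH' (mf : measurable_fun setT f)).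
pose m2 (f : pathT a0 -> pathT a0) mf :=
  mscale (nn (H `&` H')) (restr_image P mH (mf : measurable_fun setT f)).
suff : m1 (lstop t) (@measurable_lstop A a0 t) E = m2 (lstop t) (@measurable_lstop A a0 t) E.
  by [].
apply: eq_measure_path mE => r D /(depends_on_lstop t) [n nD].
suff : m1 id mid (lstop t @^-1` D) = m2 id mid (lstop t @^-1` D) by [].
apply: eq_measure_depends_on nD => s.
change ((nn H)%:num%:E * P (H `&` H' `&` cylinder (past_times t n) s) =
  (nn (H `&` H'))%:num%:E * P (H `&` cylinder (past_times t n) s)).
rewrite nnE// nnE//.
have [sa|sa] := eqVneq (s t) a.
  have sub : cylinder (past_times t n) s `<=` H.
    by move=> x xs; rewrite /H /at_time /= -sa; apply: xs; apply/past_timesP; lia.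
  rewrite setIAC (setIidr sub) [RHS]muleC muleC.
  by have := hP t n s b; rewrite sa.
have sub : cylinder (past_times t n) s `&` H = set0.
  apply/seteqP; split => // x [xs xa]; case/eqP: sa; rewrite -xa; apply/esym/xs.
  by apply/past_timesP; lia.
by rewrite setIAC ![H `&` _]setIC sub set0I !measure0 !mule0.
Qed.

(** The future is revealed one time at a time: the event that the path follows
    [s] up to time [t + n] is a past event for [t + n]. *)
Let split_future t n (s : int -> A) (E : set (pathT a0)) : measurable E ->
  P (lstop t @^-1` E `&` cylinder (future_times t n) s) * P (at_time t (s t)) =
  P (lstop t @^-1` E `&` at_time t (s t)) * P (cylinder (future_times t n) s).
Proof.
move=> mE; elim: n => [|n IH].
  rewrite (_ : cylinder _ _ = at_time t (s t))//.
  apply/seteqP; split => [x xs|x xs i /future_timesP it].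
    by apply: xs; apply/future_timesP; lia.
  by have -> : i = t by lia.
set t' := (t + n%:Z)%R; set a := s t'; set b := s (t' + 1)%R.
have cylS : cylinder (future_times t n.+1) s = cylinder (future_times t n) s `&` at_time (t' + 1)%R b.
  apply/seteqP; split => [x xs|x [xs xb] i /future_timesP it].
    split; first by move=> i /future_timesP it; apply: xs; apply/future_timesP; lia.
    by apply: xs; apply/future_timesP; lia.
  have [->|it'] := eqVneq i (t' + 1)%R; first exact: xb.
  by apply: xs; apply/future_timesP; lia.
have sub : cylinder (future_times t n) s `<=` at_time t' a.
  by move=> x xs; apply: xs; apply/future_timesP; lia.
set F := cylinder (future_times t n) s in IH cylS sub *.
set Ha := at_time t' a in sub *; set Hb := at_time (t' + 1)%R b in cylS *.
have mF : measurable (F : set (pathT a0)) by exact: measurable_cylinder.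
have key (E' : set (pathT a0)) : measurable E' ->
    P (lstop t @^-1` E' `&` F `&` Hb) * P Ha = P (lstop t @^-1` E' `&` F) * P (Ha `&` Hb).
  move=> mE'; have mE'' : measurable (lstop t @^-1` E' `&` F : set (pathT a0)).
    by apply: measurableI => //; exact: mlstop.
  have st : lstop t' @^-1` (lstop t @^-1` E' `&` F) = lstop t @^-1` E' `&` F.
    have LL x : lstop t (lstop t' x) = lstop t x.
      by apply/funext => i; rewrite /lstop; congr (x _); lia.
    have FF x : {in future_times t n, lstop t' x =1 x}.
      by move=> i /future_timesP it; rewrite /lstop; congr (x _); lia.
    apply/seteqP; split => x [H1 H2]; split; first by move: H1; rewrite /preimage/= LL.
    - by apply: depends_on_cylinder H2; exact: FF.
    - by move: H1; rewrite /preimage/= LL.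
    - by apply: depends_on_cylinder H2 => i iF; rewrite FF.
  have := step t' a b mE''; rewrite -/Ha -/Hb st setIA.
  by rewrite -[lstop t @^-1` E' `&` F `&` Ha]setIA (setIidl sub).
have keyE := key _ mE; have keyT := key _ measurableT.
rewrite preimage_setT setTI in keyT.
rewrite cylS [lstop t @^-1` E `&` (F `&` Hb)]setIA.
(* The induction step divides by the probability of the state at [t']. If it
   vanishes, so do all the events that are contained in it. *)
have [q0|q0] := eqVneq (P Ha) 0.
  have nul (X : set (pathT a0)) : measurable X -> X `<=` Ha -> P X = 0.
    move=> mX XHa; apply/eqP; rewrite eq_le measure_ge0 andbT -q0.
    by apply: le_measure; rewrite ?inE//; exact: mat.
  have mFb : measurable (F `&` Hb : set (pathT a0)) by apply: measurableI => //; exact: mat.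
  rewrite (nul (F `&` Hb))//; last exact: subIset (or_introl sub).
  rewrite mule0 -setIA (nul (_ `&` (F `&` Hb))) ?mul0e//.
    by apply: measurableI => //; exact: mlstop.
  by apply: subIset; right; exact: subIset (or_introl sub).
move: IH keyE keyT q0.
have mEl := mlstop t mE.
have mEF : measurable (lstop t @^-1` E `&` F : set (pathT a0)) by exact: measurableI.
have mb : measurable (Hb : set (pathT a0)) by exact: mat.
have ma : measurable (Ha : set (pathT a0)) by exact: mat.
have mEa : measurable (lstop t @^-1` E `&` at_time t (s t) : set (pathT a0)).
  by apply: measurableI => //; exact: mat.
rewrite -!nnE//; try (by exact: mat); try (by exact: measurableI).
rewrite -!EFinM => -[IH] [keyE] [keyT]; rewrite eqe => q0.
congr EFin; apply: (mulIf q0).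
by rewrite mulrAC keyE mulrAC IH -mulrA -keyT mulrA.
Qed.

(** Given the present, the past and the future are independent. *)
Lemma markov_splitting t a (E F : set (pathT a0)) : measurable E -> measurable F ->
  P (lstop t @^-1` E `&` at_time t a `&` rstop t @^-1` F) * P (at_time t a) =
  P (lstop t @^-1` E `&` at_time t a) * P (at_time t a `&` rstop t @^-1` F).
Proof.
move=> mE mF.
set H := at_time t a.
have mH : measurable (H : set (pathT a0)) by exact: mat.
have mEH : measurable (lstop t @^-1` E `&` H : set (pathT a0)).
  by apply: measurableI => //; exact: mlstop.
rewrite muleC -(nnE mH) -(nnE mEH).
pose m1 (f : pathT a0 -> pathT a0) mf :=
  mscale (nn H) (restr_image P mEH (mf : measurable_fun setT f)).
pose m2 (f : pathT a0 -> pathT a0) mf :=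
  mscale (nn (lstop t @^-1` E `&` H)) (restr_image P mH (mf : measurable_fun setT f)).
suff : m1 (rstop t) (@measurable_rstop A a0 t) F = m2 (rstop t) (@measurable_rstop A a0 t) F.
  by [].
apply: eq_measure_path mF => r D /(depends_on_rstop t) [n nD].
suff : m1 id mid (rstop t @^-1` D) = m2 id mid (rstop t @^-1` D) by [].
apply: eq_measure_depends_on nD => s.
change ((nn H)%:num%:E * P (lstop t @^-1` E `&` H `&` cylinder (future_times t n) s) =
  (nn (lstop t @^-1` E `&` H))%:num%:E * P (H `&` cylinder (future_times t n) s)).
rewrite nnE// nnE//.
have [sa|sa] := eqVneq (s t) a.
  have sub : cylinder (future_times t n) s `<=` H.
    by move=> x xs; rewrite /H /at_time /= -sa; apply: xs; apply/future_timesP; lia.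
  rewrite -setIA (setIidr sub) muleC.
  by have := split_future t n s mE; rewrite sa.
have sub : cylinder (future_times t n) s `&` H = set0.
  apply/seteqP; split => // x [xs xa]; case/eqP: sa; rewrite -xa; apply/esym/xs.
  by apply/future_timesP; lia.
by rewrite -setIA ![H `&` _]setIC sub setI0 !measure0 !mule0.
Qed.

End markov_splitting.

(** * Splitting the relative product at a time *)

Section splitting_integral.
Local Open Scope ereal_scope.
Context (R : realType) (C : countType) (c0 : C).
Variable P : probability (pathT c0) R.
Hypothesis hP : markov_law P.
Variables (t : int) (c : C).

Let mH : measurable (at_time t c : set (pathT c0)) := measurable_at_time c0 t c.
Let mL := @measurable_lstop C c0 t.
Let mR := @measurable_rstop C c0 t.

(** The laws of the past and of the future on the event that the state at time
    [t] is [c], not normalized. *)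
Definition past_law : {finite_measure set (pathT c0) -> \bar R} :=
  restr_image P mH mL.
Definition future_law : {finite_measure set (pathT c0) -> \bar R} :=
  restr_image P mH mR.

(** By [markov_splitting], the joint law of past and future on [at_time t c] is,
    up to the mass of this event, a product measure; then Tonelli applies. *)
Lemma integral_splitting (u v : pathT c0 -> \bar R) :
  measurable_fun setT u -> measurable_fun setT v ->
  (forall z, 0 <= u z) -> (forall z, 0 <= v z) ->
  P (at_time t c) * \int[P]_(z in at_time t c) (u (lstop t z) * v (rstop t z)) =
  (\int[past_law]_z u z) * (\int[future_law]_z v z).
Proof.
move=> mu mv u0 v0.
have mLR : measurable_fun setT (fun z : pathT c0 => (lstop t z : pathT c0, rstop t z : pathT c0)).
  by apply: measurable_fun_pair; [exact: mL|exact: mR].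
pose k : {nonneg R} := NngNum (fine_ge0 (measure_ge0 P (at_time t c))).
have kE : k%:num%:E = P (at_time t c) by rewrite /= fineK// fin_num_measure.
pose m' : {measure set (pathT c0 * pathT c0) -> \bar R} :=
  mscale k (restr_image P mH mLR).
have prodE : forall X, measurable X -> (past_law \x future_law) X = m' X.
  apply: product_measure_unique => D D' mD mD'.
  change (k%:num%:E * P (at_time t c `&` (lstop t @^-1` D `&` rstop t @^-1` D')) =
    P (at_time t c `&` lstop t @^-1` D) * P (at_time t c `&` rstop t @^-1` D')).
  rewrite kE muleC.
  have := markov_splitting hP t c mD mD'.
  by rewrite setIA ![lstop t @^-1` D `&` at_time t c]setIC.
pose w (z : pathT c0 * pathT c0) := u z.1 * v z.2.
have mw : measurable_fun setT w.
  by apply: emeasurable_funM; exact: measurableT_comp.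
have w0 z : 0 <= w z by rewrite mule_ge0.
rewrite -kE -(integral_restr_image P mH mLR mw w0) -ge0_integral_mscale//.
transitivity (\int[past_law \x future_law]_z w z).
  by apply: eq_measure_integral => X mX _; exact/esym/prodE.
rewrite fubini_tonelli1// /fubini_F /w /=.
under eq_integral do rewrite ge0_integralZl//.
rewrite ge0_integralZr//; exact: integral_ge0.
Qed.

Lemma integral_splitting_rect (u v : pathT c0 -> R) (D D' : set (pathT c0)) :
  measurable_fun setT u -> measurable_fun setT v ->
  (forall z, 0 <= u z)%R -> (forall z, 0 <= v z)%R ->
  measurable D -> measurable D' ->
  P (at_time t c) * \int[P]_(z in lstop t @^-1` D `&` rstop t @^-1` D')
    (\1_(at_time t c) z * (u (lstop t z) * v (rstop t z)))%:E =
  (\int[past_law]_(z in D) (u z)%:E) * (\int[future_law]_(z in D') (v z)%:E).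
Proof.
move=> mu mv u0 v0 mD mD'.
have muD : measurable_fun setT (fun z => (\1_D z * u z)%:E).
  by apply/measurable_EFinP; apply: measurable_funM.
have mvD : measurable_fun setT (fun z => (\1_D' z * v z)%:E).
  by apply/measurable_EFinP; apply: measurable_funM.
have indE (m : {measure set (pathT c0) -> \bar R}) (D0 : set (pathT c0)) (w : pathT c0 -> R) :
    \int[m]_(z in D0) (w z)%:E = \int[m]_z (\1_D0 z * w z)%:E.
  rewrite integral_mkcond; apply: eq_integral => z _.
  by rewrite patchE indicE; case: ifPn => _; rewrite ?mul1r ?mul0r.
rewrite (indE past_law) (indE future_law) -integral_splitting//; last 2 first.
- by move=> z; rewrite lee_fin mulr_ge0.
- by move=> z; rewrite lee_fin mulr_ge0.
congr (_ * _); rewrite (indE P) [RHS]integral_mkcond; apply: eq_integral => z _.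
rewrite patchE -EFinM !indicE in_setI.
have -> : (z \in lstop t @^-1` D) = (lstop t z \in D) by apply/idP/idP; rewrite !inE.
have -> : (z \in rstop t @^-1` D') = (rstop t z \in D') by apply/idP/idP; rewrite !inE.
case: (z \in at_time t c); case: (_ \in D); case: (_ \in D');
  by rewrite /= ?(mul1r, mul0r, mulr0).
Qed.

End splitting_integral.

Section factored_density.
Local Open Scope ereal_scope.
Context (R : realType) (A C : countType) (a0 : A) (c0 : C) (f : A -> C).
Variables (P : probability (pathT a0) R) (Q : probability (pathT c0) R).

Definition image_path (x : pathT a0) : pathT c0 := fun t => f (x t).

Lemma measurable_image_path : measurable_fun setT image_path.
Proof.
apply: measurable_into_path => t S.
exact: (measurable_coord a0 t (f @^-1` S)).
Qed.

Hypothesis hP : markov_law P.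
Hypothesis hQ : markov_law Q.
Hypothesis PQ : forall D, measurable D -> P (image_path @^-1` D) = Q D.
Variables (t : int) (a : A).
Hypothesis Pa : P (at_time t a) != 0.
Let c := f a.
Local Notation Ha := (at_time t a : set (pathT a0)).
Local Notation Hc := (at_time t c : set (pathT c0)).

Let mHa : measurable Ha := measurable_at_time a0 t a.
Let mHc : measurable Hc := measurable_at_time c0 t c.

(** The conditional probability of a past event and of the present state, given
    the past of the image process only. *)
Lemma past_density_exists (E : set (pathT a0)) : measurable E ->
  exists u, is_density (past_law Q t c)
    (fun D => P (lstop t @^-1` (E `&` image_path @^-1` D) `&` Ha)) u.
Proof.
move=> mE.
have mEH : measurable (lstop t @^-1` E `&` Ha : set (pathT a0)).
  apply: measurableI => //.
  exact: (measurable_preimage (@measurable_lstop A a0 t)).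
have mh : measurable_fun setT (image_path \o (lstop t : pathT a0 -> pathT a0)).
  by apply: measurableT_comp; [exact: measurable_image_path|exact: measurable_lstop].
have [D mD|u uE] := @density_exists _ _ _ (past_law Q t c) (restr_image P mEH mh).
  change (P (lstop t @^-1` E `&` Ha `&` (image_path \o lstop t) @^-1` D) <=
    Q (Hc `&` lstop t @^-1` D)).
  have mX : measurable (Hc `&` lstop t @^-1` D).
    apply: measurableI => //.
    exact: (measurable_preimage (@measurable_lstop C c0 t)).
  rewrite -PQ//; apply: le_measure; rewrite ?inE.
  - by apply: measurableI => //; exact: measurable_preimage.
  - exact: (measurable_preimage measurable_image_path).
  - by move=> x [[_ xa] xD]; split => //; rewrite /at_time/= /image_path xa.
exists u; case: uE => mu u0 uE; split => // D mD.
by rewrite -uE// /restr_image setIAC.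
Qed.

Lemma future_density_exists (E : set (pathT a0)) : measurable E ->
  exists u, is_density (future_law Q t c)
    (fun D => P (Ha `&` rstop t @^-1` (E `&` image_path @^-1` D))) u.
Proof.
move=> mE.
have mEH : measurable (Ha `&` rstop t @^-1` E : set (pathT a0)).
  apply: measurableI => //.
  exact: (measurable_preimage (@measurable_rstop A a0 t)).
have mh : measurable_fun setT (image_path \o (rstop t : pathT a0 -> pathT a0)).
  by apply: measurableT_comp; [exact: measurable_image_path|exact: measurable_rstop].
have [D mD|u uE] := @density_exists _ _ _ (future_law Q t c) (restr_image P mEH mh).
  change (P (Ha `&` rstop t @^-1` E `&` (image_path \o rstop t) @^-1` D) <=
    Q (Hc `&` rstop t @^-1` D)).
  have mX : measurable (Hc `&` rstop t @^-1` D).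
    apply: measurableI => //.
    exact: (measurable_preimage (@measurable_rstop C c0 t)).
  rewrite -PQ//; apply: le_measure; rewrite ?inE.
  - by apply: measurableI => //; exact: measurable_preimage.
  - exact: (measurable_preimage measurable_image_path).
  - by move=> x [[xa _] xD]; split => //; rewrite /at_time/= /image_path xa.
exists u; case: uE => mu u0 uE; split => // D mD.
by rewrite -uE// preimage_setI setIA.
Qed.

(** The splitting at [a] divides by the mass of [at_time t a], the splitting at
    [c] by the mass of [at_time t c]. *)
Let kappa : R := (fine (Q Hc) / fine (P Ha))%R.

Lemma kappa_ge0 : (0 <= kappa)%R.
Proof. by rewrite divr_ge0// fine_ge0. Qed.

(** The two sides of the defining property of a conditional density are finite
    measures of [D]. For an intersection of a past and a future event of the
    image process, both factor by the splittings of [P] and [Q]; and every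
    cylinder is such an intersection. *)
Lemma factored_cond_density (E F : set (pathT a0)) u v : measurable E -> measurable F ->
  is_density (past_law Q t c)
    (fun D => P (lstop t @^-1` (E `&` image_path @^-1` D) `&` Ha)) u ->
  is_density (future_law Q t c)
    (fun D => P (Ha `&` rstop t @^-1` (F `&` image_path @^-1` D))) v ->
  is_cond_density P image_path Q (lstop t @^-1` E `&` Ha `&` rstop t @^-1` F)
    (fun z => kappa * (\1_Hc z * (u (lstop t z) * v (rstop t z))))%R.
Proof.
move=> mE mF [mu u0 uE] [mv v0 vF].
set X := _ `&` _ `&` _; set w := fun z => _.
have mX : measurable (X : set (pathT a0)).
  apply: measurableI; [apply: measurableI|] => //.
    exact: (measurable_preimage (@measurable_lstop A a0 t)).
  exact: (measurable_preimage (@measurable_rstop A a0 t)).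
have mul : measurable_fun setT (u \o (lstop t : pathT c0 -> pathT c0)).
  by apply: measurableT_comp => //; exact: measurable_lstop.
have mvr : measurable_fun setT (v \o (rstop t : pathT c0 -> pathT c0)).
  by apply: measurableT_comp => //; exact: measurable_rstop.
have mw : measurable_fun setT w.
  apply: measurable_funM; first exact: measurable_cst.
  by apply: measurable_funM => //; exact: measurable_funM.
have w0 z : (0 <= w z)%R.
  by apply: mulr_ge0; [exact: kappa_ge0|rewrite !mulr_ge0].
have mwE : measurable_fun setT (EFin \o w) by exact/measurable_EFinP.
have w0E z : 0 <= (EFin \o w) z by rewrite lee_fin.
have rect (D D' : set (pathT c0)) : measurable D -> measurable D' ->
    P (X `&` image_path @^-1` (lstop t @^-1` D `&` rstop t @^-1` D')) =
    \int[Q]_(z in lstop t @^-1` D `&` rstop t @^-1` D') (w z)%:E.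
  move=> mD mD'.
  have mDl := measurable_preimage (@measurable_lstop C c0 t) mD.
  have mDr := measurable_preimage (@measurable_rstop C c0 t) mD'.
  have mED : measurable (E `&` image_path @^-1` D).
    by apply: measurableI => //; exact: (measurable_preimage measurable_image_path).
  have mFD : measurable (F `&` image_path @^-1` D').
    by apply: measurableI => //; exact: (measurable_preimage measurable_image_path).
  have XE : X `&` image_path @^-1` (lstop t @^-1` D `&` rstop t @^-1` D') =
      lstop t @^-1` (E `&` image_path @^-1` D) `&` Ha `&`
      rstop t @^-1` (F `&` image_path @^-1` D').
    apply/seteqP; split => x.
      by move=> [[[xE xa] xF] [xD xD']].
    by move=> [[[xE xD] xa] [xF xD']].
  have H1 := markov_splitting hP t a mED mFD.
  rewrite -XE uE// vF// in H1.
  rewrite -(integral_splitting_rect hQ t c mu mv u0 v0 mD mD') in H1.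
  set g := fun z => (_)%:E in H1.
  have -> : \int[Q]_(z in lstop t @^-1` D `&` rstop t @^-1` D') (w z)%:E =
      kappa%:E * \int[Q]_(z in lstop t @^-1` D `&` rstop t @^-1` D') g z.
    rewrite -ge0_integralZl//; last first.
    - by rewrite lee_fin kappa_ge0.
    - by move=> z _; rewrite lee_fin !mulr_ge0.
    - apply: measurable_funTS; apply/measurable_EFinP.
      by apply: measurable_funM => //; exact: measurable_funM.
    - exact: measurableI.
  have Pafin : P Ha \is a fin_num by rewrite fin_num_measure.
  rewrite /kappa EFinM fineK ?fin_num_measure// -muleA [_^-1%:E * _]muleC muleA -H1.
  rewrite -muleA -[X in X * _^-1%:E](fineK Pafin) -EFinM divff ?mule1//.
  by rewrite fine_eq0.
split => // D mD.
have wfin : \int[Q]_z (w z)%:E < +oo.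
  have := rect setT setT measurableT measurableT.
  rewrite !preimage_setT setTI preimage_setT setIT => <-.
  by rewrite ltey_eq fin_num_measure.
pose m1 := restr_image P mX measurable_image_path.
pose m2 := density_measure mwE w0E wfin.
suff : m1 D = m2 D by [].
apply: eq_measure_path mD => r D0 rD.
apply: eq_measure_depends_on rD => s.
pose rl := [seq i <- r | (i <= t)%R]; pose rr := [seq i <- r | (t <= i)%R].
have -> : cylinder r s = lstop t @^-1` (cylinder rl s) `&` rstop t @^-1` (cylinder rr s).
  apply/seteqP; split => [z zs|z [zl zr] i ir].
    split => i; rewrite mem_filter => /andP[it ir]; rewrite -zs// /lstop /rstop.
      by congr (z _); lia.
    by congr (z _); lia.
  have [it|it] := leP i t.
    rewrite -zl ?mem_filter ?it// /lstop; congr (z _); lia.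
  rewrite -zr ?mem_filter ?(ltW it)// /rstop; congr (z _); lia.
by apply: rect; exact: measurable_cylinder.
Qed.

End factored_density.

Lemma relprod_le (d1 d2 d : measure_display) (S1 : measurableType d1)
  (S2 : measurableType d2) (W : measurableType d) (R : realType)
  (P1 : probability S1 R) (P2 : probability S2 R) (p : probability W R)
  (al : S1 -> W) (be : S2 -> W) :
  measurable_fun setT al -> measurable_fun setT be ->
  (forall D, measurable D -> P1 (al @^-1` D) = p D) ->
  (forall D, measurable D -> P2 (be @^-1` D) = p D) ->
  forall E E' F F', measurable E -> measurable E' -> measurable F -> measurable F' ->
  E `<=` E' -> F `<=` F' ->
  (relprod P1 P2 p al be E F <= relprod P1 P2 p al be E' F')%E.
Proof.
move=> mal mbe law1 law2 E E' F F' mE mE' mF mF' EE' FF'.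
have [m1 m1J] := relprod_measurel mal mbe law1 law2 mF.
have [m2 m2J] := relprod_measurer mal mbe law1 law2 mE'.
apply: (@le_trans _ _ (relprod P1 P2 p al be E' F)).
  by rewrite -!m1J//; apply: le_measure; rewrite ?inE.
by rewrite -!m2J//; apply: le_measure; rewrite ?inE.
Qed.

Lemma mule_fin_cancel (R : realType) (q x y : \bar R) :
  q \is a fin_num -> q != 0%E -> x \is a fin_num -> y \is a fin_num ->
  (q * x = q * y)%E -> x = y.
Proof.
move=> qf q0 xf yf; move: q0.
rewrite -(fineK qf) -(fineK xf) -(fineK yf) -!EFinM eqe => q0 [].
by move/(mulfI q0) ->.
Qed.

Section coupled_splitting.
Local Open Scope ereal_scope.
Context (R : realType) (A B C : countType) (a0 : A) (b0 : B) (c0 : C).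
Context (f : A -> C) (g : B -> C).
Variables (P1 : probability (pathT a0) R) (P2 : probability (pathT b0) R).
Variable Q : probability (pathT c0) R.
Hypotheses (h1 : markov_law P1) (h2 : markov_law P2) (hQ : markov_law Q).
Local Notation mf := (@image_path A C a0 c0 f).
Local Notation mg := (@image_path B C b0 c0 g).
Hypothesis law1 : forall D : set (pathT c0), measurable D -> P1 (mf @^-1` D) = Q D.
Hypothesis law2 : forall D : set (pathT c0), measurable D -> P2 (mg @^-1` D) = Q D.
Let mal : measurable_fun setT mf := measurable_image_path f.
Let mbe : measurable_fun setT mg := measurable_image_path g.

Local Notation J := (relprod P1 P2 Q mf mg).

Lemma relprod_mismatch t a b : f a <> g b -> J (at_time t a) (at_time t b) = 0.
Proof.
move=> fg.
have -> : at_time t a = at_time t a `&` mf @^-1` (at_time t (f a)).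
  by apply/seteqP; split => [x xa|x []//]; split => //; rewrite /at_time/= /image_path xa.
have -> : at_time t b = at_time t b `&` mg @^-1` (at_time t (g b)).
  by apply/seteqP; split => [x xa|x []//]; split => //; rewrite /at_time/= /image_path xa.
rewrite relprod_setI//; try exact: measurable_at_time.
rewrite (_ : _ `&` _ = set0) ?integral_set0//.
by apply/seteqP; split => // z [zf zg]; apply: fg; rewrite -zf -zg.
Qed.

(** By [factored_cond_density], each of the four values of the form is, up to a
    common constant, the product of a past integral and a future integral, and
    both sides of the identity contain the same four integrals. *)
Lemma relprod_splitting t a b (E E' : set (pathT a0)) (F F' : set (pathT b0)) :
  measurable E -> measurable E' -> measurable F -> measurable F' ->
  J (lstop t @^-1` E `&` at_time t a `&` rstop t @^-1` E')
    (lstop t @^-1` F `&` at_time t b `&` rstop t @^-1` F') *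
  J (at_time t a) (at_time t b) =
  J (lstop t @^-1` E `&` at_time t a) (lstop t @^-1` F `&` at_time t b) *
  J (at_time t a `&` rstop t @^-1` E') (at_time t b `&` rstop t @^-1` F').
Proof.
move=> mE mE' mF mF'.
have mHa : measurable (at_time t a : set (pathT a0)) by exact: measurable_at_time.
have mHb : measurable (at_time t b : set (pathT b0)) by exact: measurable_at_time.
have mEl := measurable_preimage (@measurable_lstop A a0 t) mE.
have mFl := measurable_preimage (@measurable_lstop B b0 t) mF.
have mEr := measurable_preimage (@measurable_rstop A a0 t) mE'.
have mFr := measurable_preimage (@measurable_rstop B b0 t) mF'.
(* If this mass vanishes, so do both sides by monotonicity; otherwise [a] and [b]
   have the same image and all the states involved have positive mass. *)
have [J0|J0] := eqVneq (J (at_time t a) (at_time t b)) 0.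
  rewrite J0 mule0 [X in _ = X * _](_ : _ = 0) ?mul0e//.
  apply/eqP; rewrite eq_le relprod_ge0 andbT -J0; apply: relprod_le => //.
  - exact: measurableI.
  - exact: measurableI.
have fg : f a = g b by apply: contrapT => /(relprod_mismatch t) /eqP; rewrite (negbTE J0).
have Pa : P1 (at_time t a) != 0.
  apply: contraNneq J0 => P0; rewrite eq_le relprod_ge0 andbT -P0.
  exact: relprod_lel.
have Pb : P2 (at_time t b) != 0.
  apply: contraNneq J0 => P0; rewrite eq_le relprod_ge0 andbT -P0.
  exact: relprod_ler.
have Qc : Q (at_time t (f a)) != 0.
  apply: contraNneq Pa => P0; rewrite eq_le measure_ge0 andbT -P0 -law1; last first.
    exact: measurable_at_time.
  apply: le_measure; rewrite ?inE//.
    by apply: (measurable_preimage mal); exact: measurable_at_time.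
  by move=> x xa; rewrite /at_time /= /image_path xa.
pose ka := (fine (Q (at_time t (f a))) / fine (P1 (at_time t a)))%R.
pose kb := (fine (Q (at_time t (g b))) / fine (P2 (at_time t b)))%R.
have ka0 : (0 <= ka)%R by exact: kappa_ge0.
have kb0 : (0 <= kb)%R by exact: kappa_ge0.
pose isL (D1 : set (pathT a0)) := is_density (past_law Q t (f a))
  (fun D => P1 (lstop t @^-1` (D1 `&` mf @^-1` D) `&` at_time t a)).
pose isR (D1 : set (pathT a0)) := is_density (future_law Q t (f a))
  (fun D => P1 (at_time t a `&` rstop t @^-1` (D1 `&` mf @^-1` D))).
pose isL' (D2 : set (pathT b0)) := is_density (past_law Q t (g b))
  (fun D => P2 (lstop t @^-1` (D2 `&` mg @^-1` D) `&` at_time t b)).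
pose isR' (D2 : set (pathT b0)) := is_density (future_law Q t (g b))
  (fun D => P2 (at_time t b `&` rstop t @^-1` (D2 `&` mg @^-1` D))).
have formula D1 D1' D2 D2' u v u' v' :
    measurable D1 -> measurable D1' -> measurable D2 -> measurable D2' ->
    isL D1 u -> isR D1' v -> isL' D2 u' -> isR' D2' v' ->
    Q (at_time t (f a)) *
    J (lstop t @^-1` D1 `&` at_time t a `&` rstop t @^-1` D1')
      (lstop t @^-1` D2 `&` at_time t b `&` rstop t @^-1` D2') =
    (ka * kb)%:E * ((\int[past_law Q t (f a)]_z (u z * u' z)%:E) *
                    (\int[future_law Q t (f a)]_z (v z * v' z)%:E)).
  move=> mD1 mD1' mD2 mD2' uD vD uD' vD'.
  have c1 := factored_cond_density h1 hQ Pa mD1 mD1' uD vD.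
  have c2 := factored_cond_density h2 hQ Pb mD2 mD2' uD' vD'.
  have [mu u0 _] := uD; have [mv v0 _] := vD.
  have [mu' u0' _] := uD'; have [mv' v0' _] := vD'.
  rewrite (relprod_density mal mbe law1 law2 _ _ c1 c2); last 2 first.
  - apply: measurableI; [apply: measurableI => //|].
      exact: (measurable_preimage (@measurable_lstop A a0 t)).
    exact: (measurable_preimage (@measurable_rstop A a0 t)).
  - apply: measurableI; [apply: measurableI => //|].
      exact: (measurable_preimage (@measurable_lstop B b0 t)).
    exact: (measurable_preimage (@measurable_rstop B b0 t)).
  have muu : measurable_fun setT (fun z => u z * u' z)%R by exact: measurable_funM.
  have mvv : measurable_fun setT (fun z => v z * v' z)%R by exact: measurable_funM.
  have uu0 z : (0 <= u z * u' z)%R by rewrite mulr_ge0.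
  have vv0 z : (0 <= v z * v' z)%R by rewrite mulr_ge0.
  have := integral_splitting_rect hQ t (f a) muu mvv uu0 vv0 measurableT measurableT.
  rewrite !preimage_setT setTI => <-.
  rewrite [RHS]muleCA; congr (_ * _).
  rewrite -ge0_integralZl//; last first.
  - by rewrite lee_fin mulr_ge0.
  - by move=> z _; rewrite lee_fin !mulr_ge0.
  - apply/measurable_EFinP; apply: measurable_funM.
      by apply: measurable_indic; exact: measurable_at_time.
    apply: measurable_funM.
      exact: (measurableT_comp muu (@measurable_lstop C c0 t)).
    exact: (measurableT_comp mvv (@measurable_rstop C c0 t)).
  apply: eq_integral => z _; rewrite -fg -EFinM -/ka; congr EFin.
  rewrite (_ : fine (Q _) / fine (P2 _) = kb)%R; last by rewrite /kb fg.
  rewrite indicE; case: (z \in _); rewrite /= ?(mul1r, mul0r, mulr0)//.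
  by rewrite mulrACA; congr (_ * _)%R; rewrite mulrACA.
have [u uE] := past_density_exists law1 t a mE.
have [v vE] := future_density_exists law1 t a mE'.
have [u' uF] := past_density_exists law2 t b mF.
have [v' vF] := future_density_exists law2 t b mF'.
have [u1 u1E] := past_density_exists law1 t a measurableT.
have [v1 v1E] := future_density_exists law1 t a measurableT.
have [u1' u1F] := past_density_exists law2 t b measurableT.
have [v1' v1F] := future_density_exists law2 t b measurableT.
have := formula _ _ _ _ _ _ _ _ mE mE' mF mF' uE vE uF vF.
have := formula _ _ _ _ _ _ _ _ measurableT measurableT measurableT measurableT
  u1E v1E u1F v1F.
have := formula _ _ _ _ _ _ _ _ mE measurableT mF measurableT uE v1E uF v1F.
have := formula _ _ _ _ _ _ _ _ measurableT mE' measurableT mF' u1E vE u1F vF.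
rewrite !preimage_setT !setIT !setTI => F3 F2 F0 F1.
set q := Q _ in Qc F0 F1 F2 F3.
have key : q * q * (J (lstop t @^-1` E `&` at_time t a `&` rstop t @^-1` E')
    (lstop t @^-1` F `&` at_time t b `&` rstop t @^-1` F') *
    J (at_time t a) (at_time t b)) =
  q * q * (J (lstop t @^-1` E `&` at_time t a) (lstop t @^-1` F `&` at_time t b) *
  J (at_time t a `&` rstop t @^-1` E') (at_time t b `&` rstop t @^-1` F')).
  rewrite muleACA F1 F0 [RHS]muleACA F2 F3 muleACA [RHS]muleACA; congr (_ * _).
  rewrite muleACA [RHS]muleACA; congr (_ * _); exact: muleC.
have qfin : q \is a fin_num.
  exact: (fin_num_measure Q _ (measurable_at_time c0 t (f a))).
have Jfin X Y (mX : measurable X) (mY : measurable Y) : J X Y \is a fin_num :=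
  relprod_fin mal mbe law1 law2 mX mY.
apply: (mule_fin_cancel (fin_numM qfin qfin) _ _ _ key).
- by rewrite mule_eq0 negb_or Qc.
- exact: (fin_numM (Jfin _ _ (measurableI _ _ (measurableI _ _ mEl mHa) mEr)
    (measurableI _ _ (measurableI _ _ mFl mHb) mFr)) (Jfin _ _ mHa mHb)).
- exact: (fin_numM (Jfin _ _ (measurableI _ _ mEl mHa) (measurableI _ _ mFl mHb))
    (Jfin _ _ (measurableI _ _ mHa mEr) (measurableI _ _ mHb mFr))).
Qed.

End coupled_splitting.

(** * Realization on the unit interval *)

(** A bijection, so that distinct letters of the sequence in [sequence_space]
    describe distinct times. *)
Definition int_of_nat (n : nat) : int := if odd n then Negz n./2 else Posz n./2.
Definition nat_of_int (z : int) : nat :=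
  match z with Posz k => k.*2 | Negz k => k.*2.+1 end.

Lemma int_of_natK : cancel int_of_nat nat_of_int.
Proof.
move=> n; rewrite /int_of_nat; case: ifPn => on /=.
  by rewrite -[RHS]odd_double_half on.
by rewrite -[RHS]odd_double_half (negbTE on).
Qed.

Lemma nat_of_intK : cancel nat_of_int int_of_nat.
Proof.
case=> k; rewrite /int_of_nat /=; first by rewrite odd_double doubleK.
by rewrite odd_double /= uphalf_double.
Qed.

Section realization.
Local Open Scope ereal_scope.
Context (R : realType) (A B C : countType) (a0 : A) (b0 : B) (c0 : C).
Context (f : A -> C) (g : B -> C).
Variables (P1 : probability (pathT a0) R) (P2 : probability (pathT b0) R).
Variable Q : probability (pathT c0) R.
Local Notation mf := (@image_path A C a0 c0 f).
Local Notation mg := (@image_path B C b0 c0 g).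
Hypothesis law1 : forall D : set (pathT c0), measurable D -> P1 (mf @^-1` D) = Q D.
Hypothesis law2 : forall D : set (pathT c0), measurable D -> P2 (mg @^-1` D) = Q D.
Let mal : measurable_fun setT mf := measurable_image_path f.
Let mbe : measurable_fun setT mg := measurable_image_path g.

Local Notation J := (relprod P1 P2 Q mf mg).

Definition first_times (n : nat) := [seq int_of_nat i | i <- iota 0 n].

Fixpoint prefix_cylinder (K : Type) (s : seq K) : set (int -> K) :=
  if s is k :: s' then prefix_cylinder s' `&` at_time (int_of_nat (size s')) k else setT.

Let measurable_prefix_cylinder (K : countType) (k0 : K) (s : seq K) :
  measurable (prefix_cylinder s : set (pathT k0)).
Proof.
elim: s => [|k s IH] /=; first exact: measurableT.
by apply: measurableI => //; exact: measurable_at_time.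
Qed.

Let prefix_cylinderE (K : countType) (s : int -> K) n :
  prefix_cylinder (rprefix (s \o int_of_nat) n) = cylinder (first_times n) s.
Proof.
elim: n => [|n IH] /=; first by apply/seteqP; split.
rewrite IH size_rprefix; apply/seteqP; split => [x [xs xn] i|x xs].
  move=> /mapP[j]; rewrite mem_iota => /andP[_]; rewrite add0n ltnS leq_eqVlt => jn ->.
  case/orP: jn => [/eqP ->|jn]; first exact: xn.
  by apply: xs; apply: map_f; rewrite mem_iota.
split; last by apply: xs; apply: map_f; rewrite mem_iota ltnSn.
by move=> i /mapP[j]; rewrite mem_iota => jn ->; apply: xs; apply: map_f;
  rewrite mem_iota; lia.
Qed.

Let p (s : seq (A * B)) : R :=
  fine (J (prefix_cylinder (map fst s)) (prefix_cylinder (map snd s))).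

Let mA s : measurable (prefix_cylinder s : set (pathT a0)).
Proof. exact: measurable_prefix_cylinder. Qed.
Let mB s : measurable (prefix_cylinder s : set (pathT b0)).
Proof. exact: measurable_prefix_cylinder. Qed.

Let Jfin E F (mE : measurable E) (mF : measurable F) : J E F \is a fin_num :=
  relprod_fin mal mbe law1 law2 mE mF.

Let p_ge0 s : (0 <= p s)%R.
Proof. by apply: fine_ge0; exact: relprod_ge0. Qed.

Let p_nil : p [::] = 1%R.
Proof.
by rewrite /p /= (relprod_setTl mal mbe law1 law2 measurableT) probability_setT.
Qed.

Let sum_coordinate (K : countType) (k0 : K) (m : {finite_measure set (pathT k0) -> \bar R})
    (E : set (pathT k0)) t : measurable E ->
  \esum_(k in [set: K]) m (E `&` at_time t k) = m E.
Proof.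
move=> mE; rewrite -[in RHS](setIT E).
have mid : measurable_fun setT (id : pathT k0 -> pathT k0) by exact: measurable_id.
apply/esym.
apply: (@measure_countable_fibers _ _ _ (restr_image m mE mid) K (fun x : pathT k0 => x t) setT).
by move=> k; exact: measurable_at_time.
Qed.

(** Summing out the new coordinate in each argument separately, as the form is
    only known to be a measure in each of them. *)
Let p_cons s : \esum_(k in [set: A * B]) (p (k :: s))%:E = (p s)%:E.
Proof.
rewrite /p /= !size_map; set t := int_of_nat _.
set E := prefix_cylinder _; set F := prefix_cylinder _.
have mE : measurable (E : set (pathT a0)) by exact: mA.
have mF : measurable (F : set (pathT b0)) by exact: mB.
have mEa a : measurable (E `&` at_time t a : set (pathT a0)).
  by apply: measurableI => //; exact: measurable_at_time.
have mFb b : measurable (F `&` at_time t b : set (pathT b0)).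
  by apply: measurableI => //; exact: measurable_at_time.
transitivity (\esum_(k in setT `*`` (fun _ : A => [set: B]))
    J (E `&` at_time t k.1) (F `&` at_time t k.2)).
  rewrite (_ : setT `*`` _ = setT); last by apply/seteqP; split.
  by apply: eq_esum => k _; rewrite fineK//; exact: Jfin.
rewrite -(@esum_esum _ _ _ setT (fun=> setT)
    (fun a b => J (E `&` at_time t a) (F `&` at_time t b))); last first.
  by move=> a b _ _; exact: relprod_ge0.
rewrite fineK; last exact: Jfin.
transitivity (\esum_(a in [set: A]) J (E `&` at_time t a) F).
  apply: eq_esum => a _.
  have [m mJ] := relprod_measurer mal mbe law1 law2 (mEa a).
  rewrite -mJ// -(sum_coordinate m t mF).
  by apply: eq_esum => b _; rewrite mJ.
have [m mJ] := relprod_measurel mal mbe law1 law2 mF.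
rewrite -mJ// -(sum_coordinate m t mE).
by apply: eq_esum => a _; rewrite mJ.
Qed.

Local Notation P := (uniform_prob (@ltr01 R)).

(** The prefix probabilities determine the form on cylinders; a comparison of
    measures in one argument at a time extends this to all events. *)
Lemma realization_law : exists (X : R -> pathT a0) (Y : R -> pathT b0),
  [/\ measurable_fun setT X, measurable_fun setT Y &
   forall E F, measurable E -> measurable F -> P (X @^-1` E `&` Y @^-1` F) = J E F].
Proof.
have [xi [mxi xiE]] := sequence_space (a0, b0) p_ge0 p_nil p_cons.
pose X u : pathT a0 := fun t => (xi (nat_of_int t) u).1.
pose Y u : pathT b0 := fun t => (xi (nat_of_int t) u).2.
have mX : measurable_fun setT X.
  apply: measurable_into_path => t S.
  exact: (mxi (nat_of_int t) [set k | S k.1]).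
have mY : measurable_fun setT Y.
  apply: measurable_into_path => t S.
  exact: (mxi (nat_of_int t) [set k | S k.2]).
exists X, Y; split => //.
have cylE n s1 s2 : P (X @^-1` (cylinder (first_times n) s1) `&`
    Y @^-1` (cylinder (first_times n) s2)) = J (cylinder (first_times n) s1) (cylinder (first_times n) s2).
  have := xiE (fun i => (s1 (int_of_nat i), s2 (int_of_nat i))) n.
  rewrite /p fineK; last by apply: Jfin; [exact: mA|exact: mB].
  have map1 (K L : Type) (h : K -> L) (x : nat -> K) : map h (rprefix x n) = rprefix (h \o x) n.
    by elim: n => //= n ->.
  rewrite !map1 -(prefix_cylinderE s1) -(prefix_cylinderE s2) => <-.
  congr (P _); rewrite !prefix_cylinderE; apply/seteqP; split => [u [us1 us2] i ni|u us].
    rewrite [LHS]surjective_pairing; congr (_, _).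
      rewrite -us1; last by apply: map_f; rewrite mem_iota.
      by rewrite /X int_of_natK.
    rewrite -us2; last by apply: map_f; rewrite mem_iota.
    by rewrite /Y int_of_natK.
  split => _ /mapP[i + ->]; rewrite mem_iota add0n => /andP[_ ni].
    by rewrite /X int_of_natK us.
  by rewrite /Y int_of_natK us.
have XYdep n D1 D2 : depends_on (first_times n) D1 -> depends_on (first_times n) D2 ->
    P (X @^-1` D1 `&` Y @^-1` D2) = J D1 D2.
  move=> d1 d2.
  have mD1 : measurable (D1 : set (pathT a0)) := measurable_depends_on a0 d1.
  have mXD := measurable_preimage mX mD1.
  have [m mJ] := relprod_measurer mal mbe law1 law2 mD1.
  rewrite -mJ; last exact: measurable_depends_on d2.
  suff : restr_image P mXD mY D2 = m D2 by [].
  apply: eq_measure_depends_on d2 => s2; rewrite mJ; last exact: measurable_cylinder.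
  have mYD : measurable (Y @^-1` (cylinder (first_times n) s2)).
    by apply: measurable_preimage => //; exact: measurable_cylinder.
  have [m' mJ'] := relprod_measurel mal mbe law1 law2 (measurable_cylinder b0 (first_times n) s2).
  rewrite -mJ'//.
  transitivity (restr_image P mYD mX D1); first by exact: (congr1 P (setIC _ _)).
  apply: eq_measure_depends_on d1 => s1; rewrite mJ'; last exact: measurable_cylinder.
  by rewrite -cylE; exact: (congr1 P (setIC _ _)).
have times (r : seq int) : exists n, {subset r <= first_times n}.
  have [n rn] : exists n, forall i, i \in r -> (nat_of_int i < n)%N.
    elim: r => [|i r [n rn]]; first by exists 0%N.
    exists (maxn (nat_of_int i).+1 n) => j; rewrite inE => /orP[/eqP ->|/rn]; lia.
  exists n => i /rn ir; rewrite -(nat_of_intK i); apply: map_f.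
  by rewrite mem_iota.
have XYdep2 r1 r2 D1 D2 : depends_on r1 D1 -> depends_on r2 D2 ->
    P (X @^-1` D1 `&` Y @^-1` D2) = J D1 D2.
  move=> d1 d2; have [n rn] := times (r1 ++ r2).
  by apply: (XYdep n); [apply: depends_on_sub d1|apply: depends_on_sub d2] => i ir; apply: rn;
    rewrite mem_cat ir ?orbT.
move=> E F mE mF.
have mXE := measurable_preimage mX mE.
have [m mJ] := relprod_measurer mal mbe law1 law2 mE.
rewrite -mJ//; suff : restr_image P mXE mY F = m F by [].
apply: eq_measure_path mF => r2 D2 d2.
have mD2 : measurable (D2 : set (pathT b0)) := measurable_depends_on b0 d2.
rewrite mJ//.
have mYD := measurable_preimage mY mD2.
have [m' mJ'] := relprod_measurel mal mbe law1 law2 mD2.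
rewrite -mJ'//.
transitivity (restr_image P mYD mX E); first by exact: (congr1 P (setIC _ _)).
apply: eq_measure_path mE => r1 D1 d1.
rewrite mJ'; last exact: measurable_depends_on d1.
by rewrite -(XYdep2 r1 r2)//; exact: (congr1 P (setIC _ _)).
Qed.

(** The times are countable and [relprod_mismatch] makes a disagreement at each of
    them null, so that there is a point outside the union [N'] of these null
    events. Sending [N'] to this point changes no probability. *)
Lemma realization : exists (X : R -> pathT a0) (Y : R -> pathT b0),
  [/\ measurable_fun setT X, measurable_fun setT Y,
   forall u t, f (X u t) = g (Y u t) &
   forall E F, measurable E -> measurable F -> P (X @^-1` E `&` Y @^-1` F) = J E F].
Proof.
have [X [Y [mX mY XYE]]] := realization_law.
pose N t : set R := [set u | f (X u t) <> g (Y u t)].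
have mXY t (S : set (A * B)) : measurable ((fun u => (X u t, Y u t)) @^-1` S).
  rewrite (_ : _ @^-1` S = \bigcup_(k in S)
    (X @^-1` (at_time t k.1) `&` Y @^-1` (at_time t k.2))); last first.
    apply/seteqP; split => [u Su|u [[a b] Sk [/= ua ub]]]; first by exists (X u t, Y u t).
    by rewrite /preimage /= ua ub.
  rewrite bigcup_mkcond; apply: countable_bigcupT_measurable => // k.
  case: ifPn => // _; apply: measurableI; apply: measurable_preimage => //;
    exact: measurable_at_time.
have N0 t : P (N t) = 0.
  transitivity (P ((fun u => (X u t, Y u t)) @^-1` [set k | f k.1 <> g k.2])); first by [].
  rewrite measure_countable_fibers//; last by move=> k; exact: mXY.
  apply: esum1 => -[a b] /= fg.
  rewrite -[RHS](relprod_mismatch law1 law2 t fg) -XYE; try exact: measurable_at_time.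
  by congr (P _); apply/seteqP; split => u; rewrite /preimage /at_time /=;
    [case=> -> ->|case=> -> ->].
have mN t : measurable (N t) by exact: (mXY t [set k | f k.1 <> g k.2]).
pose N' := \bigcup_n N (int_of_nat n).
have mN' : measurable N' by apply: bigcupT_measurable => n; exact: mN.
have N'0 : P N' = 0.
  have : P.-negligible N'.
    apply: negligible_bigcup => n; apply/negligibleP; [exact: mN|exact: N0].
  by move/negligibleP; apply.
have [u0 u0N] : exists u, ~ N' u.
  apply: contrapT => /forallNP noN.
  have : P N' = 1.
    rewrite (_ : N' = setT) ?probability_setT//.
    by apply/seteqP; split => // u _; exact: contrapT (noN u).
  by rewrite N'0 => /eqP; rewrite eqe eq_sym oner_eq0.
pose rho u := if u \in N' then u0 else u.
have rhoN u : ~ N' (rho u).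
  by rewrite /rho; case: ifPn => // /negP uN uN'; apply: uN; rewrite inE.
have rhoE S : measurable S -> measurable (rho @^-1` S) /\ P (rho @^-1` S) = P S.
  move=> mS.
  have rS : rho @^-1` S `\` N' = S `\` N'.
    apply/seteqP; split => u [uS uN]; split => //; move: uS;
      by rewrite /preimage /rho /= memNset.
  have mrS : measurable (rho @^-1` S).
    have [Su0|Su0] := pselect (S u0).
      rewrite (_ : _ @^-1` _ = S `|` N'); first exact: measurableU.
      apply/seteqP; split => u; rewrite /preimage /rho /=; case: ifPn => uN.
      - by right; exact: set_mem.
      - by left.
      - by [].
      - by case=> // uN'; move: uN; rewrite mem_set.
    rewrite (_ : _ @^-1` _ = S `\` N'); first exact: measurableD.
    apply/seteqP; split => u; rewrite /preimage /rho /=; case: ifPn => uN //.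
    - by move=> Su; split => // uN'; move: uN; rewrite mem_set.
    - by move=> [_ nu]; case: nu; exact: set_mem.
    - by case.
  split => //.
  have null E : measurable E -> P (E `&` N') = 0.
    move=> mE; apply/eqP; rewrite eq_le measure_ge0 andbT -N'0.
    by apply: le_measure; rewrite ?inE//; exact: measurableI.
  rewrite (measureDI P mrS mN') (measureDI P mS mN').
  by rewrite [X in _ + X = _](null _ mrS) [X in _ = _ + X](null _ mS) rS.
exists (X \o rho), (Y \o rho); split.
- by move=> _ E mE; rewrite setTI; exact: (rhoE _ (measurable_preimage mX mE)).1.
- by move=> _ E mE; rewrite setTI; exact: (rhoE _ (measurable_preimage mY mE)).1.
- move=> u t; apply: contrapT => fg; apply: (rhoN u).
  by exists (nat_of_int t) => //; rewrite /N nat_of_intK.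
- move=> E F mE mF; rewrite -XYE//.
  exact: (rhoE _ (measurableI _ _ (measurable_preimage mX mE)
    (measurable_preimage mY mF))).2.
Qed.

End realization.

(** * Processes and their laws *)

Section process_law.
Context (R : realType) (d : measure_display) (T : measurableType d).
Context (P : probability T R) (A : countType) (a0 : A) (X : int -> T -> A).

Definition has_law (p : probability (pathT a0) R) :=
  forall E, measurable E -> p E = P (path_of X @^-1` E).

Lemma measurable_path_of : is_process X -> measurable_fun setT (path_of X : T -> pathT a0).
Proof. by move=> pX; apply: measurable_into_path => t S; exact: pX. Qed.

Lemma has_law_exists : is_process X -> exists p, has_law p.
Proof.
move=> /measurable_path_of mX.
pose X' : {mfun T >-> pathT a0} := HB.pack (path_of X : T -> pathT a0)
  (isMeasurableFun.Build _ _ _ _ _ mX).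
by exists (distribution P X').
Qed.

Variable p : probability (pathT a0) R.
Hypothesis pX : is_process X.
Hypothesis pE : has_law p.

Let mX := measurable_path_of pX.

Lemma preimage_past t n (x : int -> A) :
  path_of X @^-1` (cylinder (past_times t n) x) =
  [set w | forall k, (k <= n)%N -> X (t - k%:Z) w = x (t - k%:Z)].
Proof.
apply/seteqP; split => w wx.
  by move=> k kn; apply: wx; apply/past_timesP; lia.
move=> i /past_timesP it; have -> : i = t - `|t - i|%N%:Z by lia.
by apply: wx; lia.
Qed.

Let mcyl r s : measurable (path_of X @^-1` (cylinder r s)).
Proof. exact: (measurable_preimage mX (measurable_cylinder a0 r s)). Qed.

Let mev t a : measurable [set w | X t w = a].
Proof. exact: (pX t [set a]). Qed.

(** The ratios defining the conditional probabilities are cross-multiplied; the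
    past is allowed to be null. *)
Lemma markov_property_law : markov_property P X -> markov_law p.
Proof.
move=> mk t n x b.
have := mk t n (fun k => x (t - k%:Z)) b; rewrite -preimage_past subr0.
set past := path_of X @^-1` _ => mk'.
set now := [set w | X t w = x t] in mk'; set next := [set w | X (t + 1) w = b] in mk'.
have mpast : measurable past by exact: mcyl.
have mnow : measurable now by exact: mev.
have mnext : measurable next by exact: mev.
have pastnow : past `<=` now.
  by move=> w /(_ t); apply; apply/past_timesP; lia.
rewrite !pE; try (by repeat apply: measurableI; solve [exact: measurable_cylinder | exact: measurable_at_time]).
change ((P (past `&` next) * P now)%E = (P past * P (now `&` next))%E).
have [P0|P0] := eqVneq (P past) 0%E.
  rewrite P0 mul0e [X in (X * _)%E](_ : _ = 0%E) ?mul0e//.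
  apply/eqP; rewrite eq_le measure_ge0 andbT -P0.
  by apply: le_measure; rewrite ?inE//; exact: measurableI.
have Ppast : (0 < P past)%E by rewrite lt0e P0 measure_ge0.
have Pnow : P now != 0%E.
  by rewrite gt_eqF// (lt_le_trans Ppast)//; apply: le_measure; rewrite ?inE.
have := mk' Ppast; rewrite /cprob ![next `&` _]setIC => H.
rewrite -(fineK (fin_num_measure P _ (measurableI _ _ mpast mnext))).
rewrite -(fineK (fin_num_measure P _ mnow)) -(fineK (fin_num_measure P _ mpast)).
rewrite -(fineK (fin_num_measure P _ (measurableI _ _ mnow mnext))) -!EFinM.
congr EFin; move/eqP: H; rewrite eqr_div ?fine_eq0 ?fin_num_measure//.
by move/eqP ->; rewrite mulrC.
Qed.

Lemma law_markov_property : markov_law p -> markov_property P X.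
Proof.
move=> mk t n x b past Ppast.
pose x' (i : int) := x `|t - i|%N.
have := mk t n x' b.
have pastE : past = path_of X @^-1` (cylinder (past_times t n) x').
  rewrite preimage_past; apply/seteqP; split => w wx k kn; rewrite wx// /x';
    congr x; lia.
rewrite !pE; try (by repeat apply: measurableI; solve [exact: measurable_cylinder | exact: measurable_at_time]).
have -> : x' t = x 0%N by rewrite /x' subrr.
set now := [set w | X t w = x 0%N]; set next := [set w | X (t + 1) w = b].
have mpast : measurable past by rewrite pastE; exact: mcyl.
have mnow : measurable now by exact: mev.
have mnext : measurable next by exact: mev.
have pastnow : past `<=` now.
  by move=> w /(_ 0%N (leq0n _)); rewrite subr0.
rewrite preimage_setI -pastE.
change ((P (past `&` next) * P now)%E = (P past * P (now `&` next))%E -> cprob P next past = cprob P next now).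
have Pnow : P now != 0%E.
  by rewrite gt_eqF// (lt_le_trans Ppast)//; apply: le_measure; rewrite ?inE.
rewrite /cprob ![next `&` _]setIC => /(congr1 fine).
rewrite !fineM ?fin_num_measure//; try exact: measurableI.
move=> H; have P0 : P past != 0%E by rewrite gt_eqF.
apply/eqP; rewrite eqr_div ?fine_eq0 ?fin_num_measure//.
by rewrite H mulrC.
Qed.

Definition path_shift (x : pathT a0) : pathT a0 := fun t => x (t + 1).

Lemma measurable_path_shift : measurable_fun setT path_shift.
Proof. by apply: measurable_into_path => t S; exact: measurable_coord. Qed.

Lemma stationary_shift : stationary P X ->
  forall E : set (pathT a0), measurable E -> p (path_shift @^-1` E) = p E.
Proof.
move=> st E mE; rewrite !pE//; last exact: (measurable_preimage measurable_path_shift).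
by rewrite (st E mE).
Qed.

(** For a stationary process the numerator and the denominator of the transition
    probabilities are separately constant in time. *)
Lemma stationary_time_homogeneous : stationary P X -> time_homogeneous P X.
Proof.
move=> st.
have const (q : int -> \bar R) : (forall s, q s = q (s + 1)) -> forall s t, q s = q t.
  move=> q1.
  have qk s (k : nat) : q (s + k%:Z) = q s.
    elim: k => [|k IH]; first by rewrite addr0.
    by rewrite -IH [RHS]q1; congr q; lia.
  move=> s t; have [st'|ts] := leP s t.
    by rewrite -(qk s `|t - s|%N); congr q; lia.
  by rewrite -(qk t `|s - t|%N); congr q; lia.
have inv (E : set (pathT a0)) : measurable E ->
    P (path_of X @^-1` E) = P (path_of X @^-1` (path_shift @^-1` E)).
  by move=> mE; rewrite (st E mE).
move=> s t a b _ _; rewrite /cprob; congr (fine _ / fine _).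
  apply: (const (fun s => P ([set w | X (s + 1) w = b] `&` [set w | X s w = a]))) => {}s.
  have mE : measurable (at_time (s + 1) b `&` at_time s a : set (pathT a0)).
    by apply: measurableI; exact: measurable_at_time.
  exact: (inv _ mE).
apply: (const (fun s => P [set w | X s w = a])) => {}s.
exact: (inv _ (measurable_at_time a0 s a)).
Qed.

End process_law.

(** * The coupled chain *)

Section conditional_probability.
Context (R : realType) (d : measure_display) (T : measurableType d).
Context (P : probability T R) (C : countType) (c0 : C) (Z : int -> T -> C).
Variable Q : probability (pathT c0) R.
Hypothesis pZ : is_process Z.
Hypothesis QZ : has_law P Z Q.

Lemma cond_prob_of_density (E : set T) (u : pathT c0 -> R) :
  measurable E -> measurable_fun setT u -> (forall z, 0 <= u z) ->
  (forall D : set (pathT c0), measurable D ->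
    P (E `&` path_of Z @^-1` D) = \int[Q]_(z in D) (u z)%:E)%E ->
  is_cond_prob P (sigma_process Z) E (u \o path_of Z).
Proof.
move=> mE mu u0 uE.
have mZ := @measurable_path_of _ _ _ c0 Z pZ.
have muZ : measurable_fun setT (u \o (path_of Z : T -> pathT c0)).
  exact: measurableT_comp.
have intE (D : set (pathT c0)) : measurable D ->
    (\int[P]_(w in path_of Z @^-1` D) ((u \o path_of Z) w)%:E = \int[Q]_(z in D) (u z)%:E)%E.
  move=> mD; transitivity (\int[pushforward P (path_of Z : T -> pathT c0)]_(z in D) (u z)%:E)%E.
    rewrite ge0_integral_pushforward//.
    - by apply/measurable_EFinP/measurable_funTS.
    - by move=> z _; rewrite lee_fin.
  by apply: eq_measure_integral => D' mD' _; rewrite -[RHS]/(Q D') QZ.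
split.
- move=> B mB; exists (u @^-1` B); first exact: (measurable_preimage mu mB).
  by rewrite setTI.
- apply/integrableP; split; first exact/measurable_EFinP.
  rewrite (eq_integral (fun w => ((u \o path_of Z) w)%:E)); last first.
    by move=> w _; rewrite gee0_abs ?lee_fin; [|exact: u0].
  have := intE setT measurableT; rewrite preimage_setT => ->.
  by rewrite -uE// ltey_eq fin_num_measure// preimage_setT setIT.
- move=> _ [D mD <-]; rewrite setTI uE//.
  exact: (intE D mD).
Qed.

End conditional_probability.

Section pair_process.
Context (R : realType) (A B C : countType) (a0 : A) (b0 : B) (c0 : C).
Context (f : A -> C) (g : B -> C).
Variables (P1 : probability (pathT a0) R) (P2 : probability (pathT b0) R).
Variable Q : probability (pathT c0) R.
Local Notation mf := (@image_path A C a0 c0 f).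
Local Notation mg := (@image_path B C b0 c0 g).
Hypothesis law1 : forall D : set (pathT c0), measurable D -> P1 (mf @^-1` D) = Q D.
Hypothesis law2 : forall D : set (pathT c0), measurable D -> P2 (mg @^-1` D) = Q D.
Let mal : measurable_fun setT mf := measurable_image_path f.
Let mbe : measurable_fun setT mg := measurable_image_path g.
Local Notation J := (relprod P1 P2 Q mf mg).

(** The shift of paths is invertible and commutes with the coordinatewise maps. *)
Lemma relprod_shift :
  (forall E : set (pathT a0), measurable E -> P1 (@path_shift A a0 @^-1` E) = P1 E) ->
  (forall F : set (pathT b0), measurable F -> P2 (@path_shift B b0 @^-1` F) = P2 F) ->
  (forall D : set (pathT c0), measurable D -> Q (@path_shift C c0 @^-1` D) = Q D) ->
  forall E F, measurable E -> measurable F ->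
  J (@path_shift A a0 @^-1` E) (@path_shift B b0 @^-1` F) = J E F.
Proof.
move=> i1 i2 iQ E F mE mF.
pose unshift (z : pathT c0) : pathT c0 := fun t => z (t - 1).
have mus : measurable_fun setT unshift.
  by apply: measurable_into_path => t S; exact: measurable_coord.
have sK : cancel (@path_shift C c0) unshift.
  by move=> z; apply/funext => t; rewrite /unshift /path_shift subrK.
have uE := cond_densityP mal law1 mE; have uF := cond_densityP mbe law2 mF.
have mS := @measurable_path_shift C c0.
have sE := is_cond_density_equivariant mal mS mus sK (fun x => erefl) i1 iQ mE uE.
have sF := is_cond_density_equivariant mbe mS mus sK (fun x => erefl) i2 iQ mF uF.
rewrite (relprod_density mal mbe law1 law2 _ _ sE sF); last 2 first.
- exact: (measurable_preimage (@measurable_path_shift A a0)).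
- exact: (measurable_preimage (@measurable_path_shift B b0)).
have [mu u0 _] := uE; have [mv v0 _] := uF.
pose w (z : pathT c0) := (cond_density P1 mf Q E z * cond_density P2 mg Q F z)%:E.
transitivity (\int[pushforward Q (@path_shift C c0)]_z w z)%E.
  rewrite ge0_integral_pushforward//.
  - by apply/measurable_EFinP; exact: measurable_funM.
  - by move=> z _; rewrite lee_fin mulr_ge0.
by apply: eq_measure_integral => D mD _; exact: iQ.
Qed.

Variables (d : measure_display) (T : measurableType d) (P : probability T R).
Variables (X : int -> T -> A) (Y : int -> T -> B).
Hypothesis pX : is_process X.
Hypothesis pY : is_process Y.
Hypothesis XYE : forall E F, path_measurable A E -> path_measurable B F ->
  P (path_of X @^-1` E `&` path_of Y @^-1` F) = J E F.

Local Notation XY := (fun t w => (X t w, Y t w)).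

Lemma pair_is_process : is_process XY.
Proof.
move=> t S.
rewrite (_ : _ @^-1` S = \bigcup_(k in S) (X t @^-1` [set k.1] `&` Y t @^-1` [set k.2])).
  rewrite bigcup_mkcond; apply: countable_bigcupT_measurable => // k.
  by case: ifPn => // _; apply: measurableI; [exact: pX|exact: pY].
apply/seteqP; split => [w Sw|w [[a b] Sk [/= wa wb]]]; first by exists (X t w, Y t w).
by rewrite /preimage /= wa wb.
Qed.

Let cyl_pair r (s : int -> A * B) : path_of XY @^-1` (cylinder r s) =
  path_of X @^-1` (cylinder r (fst \o s)) `&` path_of Y @^-1` (cylinder r (snd \o s)).
Proof.
apply/seteqP; split => [w ws|w [wa wb] i ir].
  by split => i ir /=; rewrite -(ws i ir).
rewrite [RHS]surjective_pairing /path_of; congr (_, _); [exact: (wa i ir)|exact: (wb i ir)].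
Qed.

Lemma pair_stationary :
  (forall E : set (pathT a0), measurable E -> P1 (@path_shift A a0 @^-1` E) = P1 E) ->
  (forall F : set (pathT b0), measurable F -> P2 (@path_shift B b0 @^-1` F) = P2 F) ->
  (forall D : set (pathT c0), measurable D -> Q (@path_shift C c0 @^-1` D) = Q D) ->
  stationary P XY.
Proof.
move=> i1 i2 iQ E mE.
have pXY := pair_is_process.
have pXY' : is_process (fun t => XY (t + 1)) by move=> t S; exact: pXY.
have [m1 m1E] := has_law_exists P (a0, b0) pXY.
have [m2 m2E] := has_law_exists P (a0, b0) pXY'.
rewrite -[LHS]m1E// -[RHS]m2E//.
apply: eq_measure_path mE => r D rD; apply: eq_measure_depends_on rD => s.
have e1 := m1E _ (measurable_cylinder (a0, b0) r s).
have e2 := m2E _ (measurable_cylinder (a0, b0) r s).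
rewrite [LHS]e1 [RHS]e2 cyl_pair XYE; try exact: measurable_cylinder.
rewrite -(relprod_shift i1 i2 iQ); try exact: measurable_cylinder.
rewrite -XYE.
- congr (P _); apply/seteqP; split => [w [wa wb] i ir|w ws].
    by rewrite [RHS]surjective_pairing /path_of; congr (_, _); [exact: (wa i ir)|exact: (wb i ir)].
  by split => i ir /=; rewrite /path_shift -(ws i ir).
- exact: (measurable_preimage (@measurable_path_shift A a0) (measurable_cylinder _ _ _)).
- exact: (measurable_preimage (@measurable_path_shift B b0) (measurable_cylinder _ _ _)).
Qed.

Hypotheses (h1 : markov_law P1) (h2 : markov_law P2) (hQ : markov_law Q).

(** The past event contains the present state and depends only on times up to
    [t], so that [relprod_splitting] applies to it. *)
Lemma pair_markov : markov_property P XY.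
Proof.
have pXY := pair_is_process.
have [p pE] := has_law_exists P (a0, b0) pXY.
apply: (law_markov_property pXY pE) => t n x b.
pose E : set (pathT a0) := cylinder (past_times t n) (fst \o x).
pose F : set (pathT b0) := cylinder (past_times t n) (snd \o x).
pose E' : set (pathT a0) := at_time (t + 1) b.1.
pose F' : set (pathT b0) := at_time (t + 1) b.2.
have mE : measurable E by exact: measurable_cylinder.
have mF : measurable F by exact: measurable_cylinder.
have mE' : measurable E' by exact: measurable_at_time.
have mF' : measurable F' by exact: measurable_at_time.
have mHa : measurable (at_time t (x t).1 : set (pathT a0)) by exact: measurable_at_time.
have mHb : measurable (at_time t (x t).2 : set (pathT b0)) by exact: measurable_at_time.
have past_stop (K : countType) (s : int -> K) :
    lstop t @^-1` (cylinder (past_times t n) s) `&` at_time t (s t) = cylinder (past_times t n) s.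
  have LL (z : int -> K) : {in past_times t n, lstop t z =1 z}.
    by move=> i /past_timesP it; rewrite /lstop; congr (z _); lia.
  apply/seteqP; split => [z [zs _] i ir|z zs].
    by rewrite -(zs i ir) LL.
  split; first by move=> i ir; rewrite LL//; exact: zs.
  by apply: zs; apply/past_timesP; lia.
have future_stop (K : countType) (k : K) :
    rstop t @^-1` (at_time (t + 1) k) = at_time (t + 1) k.
  by apply/seteqP; split => z; rewrite /preimage /at_time /= /rstop;
    rewrite (_ : Num.max (t + 1) t = t + 1)//; lia.
have := relprod_splitting h1 h2 hQ law1 law2 t (x t).1 (x t).2 mE mE' mF mF'.
rewrite !future_stop (past_stop _ (fst \o x)) (past_stop _ (snd \o x)).
have mat (s : int) k : measurable (at_time s k : set (pathT (a0, b0))).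
  exact: measurable_at_time.
have mc : measurable (cylinder (past_times t n) x : set (pathT (a0, b0))) by exact: measurable_cylinder.
rewrite !pE//; try exact: measurableI.
have at_pair s k : path_of XY @^-1` (at_time s k) =
    path_of X @^-1` (at_time s k.1) `&` path_of Y @^-1` (at_time s k.2).
  apply/seteqP; split => [w <-//|w [wa wb]].
  by rewrite /preimage /at_time /path_of /= [RHS]surjective_pairing -wa -wb.
have mEE := measurableI _ _ mE mE'; have mFF := measurableI _ _ mF mF'.
have maE := measurableI _ _ mHa mE'; have mbF := measurableI _ _ mHb mF'.
rewrite !preimage_setI !at_pair cyl_pair -!XYE//.
rewrite -/E -/F -/E' -/F' !preimage_setI => H.
by rewrite setIACA H [X in (_ * P X)%E]setIACA.
Qed.

End pair_process.

Theorem theorem3 (R : realType) (A B C : countType)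
    (dA dB dC : measure_display)
    (TA : measurableType dA) (TB : measurableType dB) (TC : measurableType dC)
    (PA : probability TA R) (PB : probability TB R) (PC : probability TC R)
    (Xbar : int -> TA -> A) (Ybar : int -> TB -> B) (Zbar : int -> TC -> C)
    (f : A -> C) (g : B -> C)
    (hX : stationary_markov_chain PA Xbar)
    (hY : stationary_markov_chain PB Ybar)
    (hZ : stationary_markov_chain PC Zbar)
    (hfX : eq_law PA (fun t w => f (Xbar t w)) PC Zbar)
    (hgY : eq_law PC Zbar PB (fun t w => g (Ybar t w))) :
  exists (d : measure_display) (T : measurableType d) (P : probability T R)
         (X : int -> T -> A) (Y : int -> T -> B),
    stationary_markov_chain P (fun t w => (X t w, Y t w)) /\
    eq_law P X PA Xbar /\
    eq_law P Y PB Ybar /\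
    (forall t w, f (X t w) = g (Y t w)) /\
    cond_independent P X Y (fun t w => f (X t w)).
Proof.
have [pX stX mkX _] := hX; have [pY stY mkY _] := hY; have [pZ stZ mkZ _] := hZ.
pose a0 : A := Xbar 0 point; pose b0 : B := Ybar 0 point; pose c0 : C := Zbar 0 point.
have [P1 P1E] := has_law_exists PA a0 pX.
have [P2 P2E] := has_law_exists PB b0 pY.
have [Q QE] := has_law_exists PC c0 pZ.
have mal := @measurable_image_path A C a0 c0 f.
have mbe := @measurable_image_path B C b0 c0 g.
have law1 (D : set (pathT c0)) : measurable D ->
    P1 (@image_path A C a0 c0 f @^-1` D) = Q D.
  move=> mD; rewrite P1E; last exact: measurable_preimage.
  by rewrite QE// -(hfX D mD).
have law2 (D : set (pathT c0)) : measurable D ->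
    P2 (@image_path B C b0 c0 g @^-1` D) = Q D.
  move=> mD; rewrite P2E; last exact: measurable_preimage.
  by rewrite QE// (hgY D mD).
have [X0 [Y0 [mX mY fg XYE]]] := realization law1 law2.
pose P := uniform_prob (@ltr01 R).
pose X (t : int) (w : measurableTypeR R) : A := X0 w t.
pose Y (t : int) (w : measurableTypeR R) : B := Y0 w t.
have qX : is_process X.
  by move=> t S; exact: (measurable_preimage mX (measurable_coord a0 t S)).
have qY : is_process Y.
  by move=> t S; exact: (measurable_preimage mY (measurable_coord b0 t S)).
exists _, _, P, X, Y.
have XE E : path_measurable A E -> P (path_of X @^-1` E) = P1 E.
  move=> mE; rewrite -(relprod_setTr mal mbe law1 law2 mE) -XYE//.
  by rewrite preimage_setT setIT.
have YE F : path_measurable B F -> P (path_of Y @^-1` F) = P2 F.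
  move=> mF; rewrite -(relprod_setTl mal mbe law1 law2 mF) -XYE//.
  by rewrite preimage_setT setTI.
have i1 := stationary_shift P1E stX.
have i2 := stationary_shift P2E stY.
have iQ := stationary_shift QE stZ.
have h1 := markov_property_law pX P1E mkX.
have h2 := markov_property_law pY P2E mkY.
have hQ := markov_property_law pZ QE mkZ.
have pXY := pair_is_process qX qY.
have stXY : stationary P (fun t w => (X t w, Y t w)).
  exact: (pair_stationary law1 law2 qX qY XYE i1 i2 iQ).
split.
  split => //.
    exact: (pair_markov law1 law2 qX qY XYE h1 h2 hQ).
  exact: (stationary_time_homogeneous (a0, b0) stXY).
split; first by move=> E mE; exact: etrans (XE E mE) (P1E E mE).
split; first by move=> F mF; exact: etrans (YE F mF) (P2E F mF).
split; first by move=> t w; exact: fg.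
pose Z (t : int) (w : measurableTypeR R) : C := f (X t w).
have qZ : is_process Z by move=> t S; exact: (qX t (f @^-1` S)).
have QZ : has_law P Z Q.
  move=> D mD; rewrite -law1// -XE; last exact: (measurable_preimage mal).
  by [].
have ZY D : path_of Z @^-1` D = path_of Y @^-1` (@image_path B C b0 c0 g @^-1` D).
  rewrite (_ : path_of Z = @image_path B C b0 c0 g \o path_of Y)//.
  by apply/funext => w; apply/funext => t; exact: fg.
move=> _ _ [E mE <-] [F mF <-]; rewrite !setTI.
have [mu u0 uE] := cond_densityP mal law1 mE.
have [mv v0 vF] := cond_densityP mbe law2 mF.
have mED (D : set (pathT c0)) (mD : measurable D) :
    path_measurable A (E `&` @image_path A C a0 c0 f @^-1` D) :=
  measurableI _ _ (mE : measurable (E : set (pathT a0))) (measurable_preimage mal mD).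
have mFD (D : set (pathT c0)) (mD : measurable D) :
    path_measurable B (F `&` @image_path B C b0 c0 g @^-1` D) :=
  measurableI _ _ (mF : measurable (F : set (pathT b0))) (measurable_preimage mbe mD).
set u := cond_density P1 _ _ _ in mu u0 uE.
set v := cond_density P2 _ _ _ in mv v0 vF.
have mXE : measurable (path_of X @^-1` E) := measurable_preimage mX mE.
have mYF : measurable (path_of Y @^-1` F) := measurable_preimage mY mF.
exists (u \o path_of Z), (v \o path_of Z), ((fun z => u z * v z) \o path_of Z); split.
- apply: (cond_prob_of_density qZ QZ mXE mu u0) => D mD.
  by rewrite -uE// -XE//; exact: mED.
- apply: (cond_prob_of_density qZ QZ mYF mv v0) => D mD.
  by rewrite -vF// -YE; [rewrite ZY|exact: mFD].
- apply: (cond_prob_of_density qZ QZ (measurableI _ _ mXE mYF)).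
  + exact: measurable_funM.
  + by move=> z; rewrite mulr_ge0.
  + move=> D mD; have := relprod_setI mal mbe law1 law2 mE mF mD (@measurableT _ (pathT c0)).
    rewrite ?preimage_setT !setIT => <-.
    rewrite -XYE//; last exact: mED.
    by rewrite setIAC.
- exact: aeW.
Qed.
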